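(* Let $n,a,b,c,d,N\ge 0$ be integers. Let $\lambda=((n+b+c)^{n+a},(n+c)^{d})$ and let $\pi=\lambda/(c^a)$. Then \[ s_\pi(1,q,q^2,\dots,q^N) =q^{\sum_{(i,j)\in \lambda/(c^a)}(\lambda_j ' -i)} \prod_{i=1}^{b}(q^{N-a +1+i};q)_{a} \prod_{i=1}^{d} (q^{N+2-i};q)_{c} \prod_{i=1}^n (q^{N-n-a-d+1+i};q)_{n+a+b+c+d} \] \[ \times \prod_{i=1}^n \prod_{j=1}^{a}\prod_{k=1}^{c}\frac{1-q^{i+j+k-1}}{1-q^{i+j+k-2}} \cdot \prod_{(i,j)\in \lambda\setminus(0^n,c^a)}\frac{1}{1-q^{h_\lambda (i,j)}}. \]
   Context: Partitions are identified with their Young diagrams $\{(i,j):1\le i\le\ell(\lambda),1\le j\le\lambda_i\}$; $(x^k)$ denotes $k$ parts equal to $x$; $\lambda/\mu$ is the set difference of diagrams. $\lambda'$ is the conjugate partition and $h_\lambda(i,j)=\lambda_i+\lambda'_j-i-j+1$ is the hook length. $(0^n,c^a)$ denotes the set of cells $(c^{n+a})/(c^n)$, i.e. the $a\times c$ rectangle of cells $(i,j)$ with $n+1\le i\le n+a$, $1\le j\le c$. $(x;q)_k=(1-x)(1-xq)\cdots(1-xq^{k-1})$. A semistandard Young tableau of shape $\pi$ is a filling of the cells of $\pi$ by nonnegative integers, weakly increasing along rows and strictly increasing down columns; $s_\pi(1,q,\dots,q^N)=\sum_T q^{|T|}$, the sum over semistandard Young tableaux $T$ of shape $\pi$ with all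 entries in $\{0,1,\dots,N\}$, where $|T|$ is the sum of the entries. *)

(* Defs.v *)
From HB Require Import structures.
From mathcomp Require Export all_boot all_order all_algebra.

Set Implicit Arguments.
Unset Strict Implicit.
Unset Printing Implicit Defensive.

Import Order.TTheory GRing.Theory Num.Theory.
Local Open Scope ring_scope.

(* A partition is a weakly decreasing sequence of natural numbers; trailing
   zero parts are allowed and do not affect the notions below.  Rows, columns
   and cells are numbered from 1. *)
Definition cell : Type := (nat * nat)%type.

Definition part (lam : seq nat) (i : nat) : nat := nth 0%N lam i.-1.

Definition conj_part (lam : seq nat) (j : nat) : nat := count (leq j) lam.

Definition diagram (lam : seq nat) : seq cell :=
  [seq (i, j) | i <- iota 1 (size lam), j <- iota 1 (part lam i)].

Definition cells_diff (A B : seq cell) : seq cell :=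
  [seq x <- A | x \notin B].

Definition skew (lam mu : seq nat) : seq cell :=
  cells_diff (diagram lam) (diagram mu).

Definition hook (lam : seq nat) (x : cell) : int :=
  (part lam x.1)%:Z + (conj_part lam x.2)%:Z - x.1%:Z - x.2%:Z + 1.

Definition semistandard (pi : seq cell) (N : nat)
    (T : {ffun seq_sub pi -> 'I_N.+1}) : bool :=
  [forall x : seq_sub pi, forall y : seq_sub pi,
     (((val x).1 == (val y).1) && ((val x).2 < (val y).2)%N
        ==> (T x <= T y)%N)
  && (((val x).2 == (val y).2) && ((val x).1 < (val y).1)%N
        ==> (T x < T y)%N)].

(* The principal specialization s_pi(1, q, ..., q^N). *)
Definition schur_principal (F : fieldType) (pi : seq cell) (N : nat) (q : F)
    : F :=
  \sum_(T : {ffun seq_sub pi -> 'I_N.+1} | semistandard T)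
     q ^+ (\sum_(x : seq_sub pi) T x)%N.

Definition qpoch (F : fieldType) (x q : F) (k : nat) : F :=
  \prod_(0 <= m < k) (1 - x * q ^+ m).

(* The indeterminate q of the field Q(q). *)
Definition ratq : {fraction {poly rat}} := tofrac 'X.

(* Main.v *)
(** The tableau sum is evaluated by the Jacobi-Trudi determinant
    [det h_(lam_i - i - mu_j + j)], proved by removing the largest letter: both
    sides satisfy the same recursion over interlacing partitions.

    Write [S(n,a,d)] for the determinant of the shape of the theorem, with
    [b, c] and the number of variables fixed.  Desnanot-Jacobi condensation
    stays inside this family:
      [S(n,a,d) S(n,a-1,d-1) =
         S(n,a-1,d) S(n,a,d-1) - S(n+1,a-1,d-1) S(n-1,a,d)],
    and so the closed form follows by induction, as soon as the number of
    variables is at least the number of rows, so that one may divide.  For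
    [n = 0] the shape is a disjoint union of two rectangles; for [a = 0] it is
    a fat hook, and so is its rotation by 180 degrees for [d = 0]; rectangles
    and fat hooks are condensed in the same way.  Each of the three inductions
    reduces to
      [V (1 - Z) (1 - W) = (1 - Z V) (1 - W V) - (1 - Z W V) (1 - V)].

    Finally both sides of the theorem are polynomials in [q^N], so that an
    identity for large [N] holds for all [N]. *)

Require Import Defs.
From mathcomp Require Import perm zify ring.
Set Implicit Arguments.
Unset Strict Implicit.
Unset Printing Implicit Defensive.
Import GRing.Theory.
Local Open Scope ring_scope.

(** * Condensation of determinants *)

(** Minors on consecutive rows and columns of an infinite array: all minors in a condensation step
    are again of this kind, with a shifted corner or a smaller size. *)
Definition wdet (R : comNzRingType) (f : nat -> nat -> R) (n x y : nat) : R :=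
  \det (\matrix_(i < n, j < n) f (x + i)%N (y + j)%N).

Section Condensation.

Variable R : comNzRingType.
Implicit Types f : nat -> nat -> R.

Lemma wdet_eq f g n x y x' y' :
    (forall i j, (i < n)%N -> (j < n)%N ->
       f (x + i)%N (y + j)%N = g (x' + i)%N (y' + j)%N) ->
  wdet f n x y = wdet g n x' y'.
Proof.
move=> efg; congr (\det _); apply/matrixP; rewrite /= => i j; rewrite !mxE.
by apply: efg.
Qed.

Let border n (u v : 'I_n.+2 -> R) (M : 'M[R]_n.+2) : 'M[R]_n.+2 :=
  \matrix_(i, j) if j == ord0 then u i else
                 if j == ord_max then v i else M i j.

Lemma ord_max_neq0 n : (ord_max : 'I_n.+2) != ord0. Proof. by []. Qed.

(** The first row of the identity vanishes off the extreme columns, so expanding along it leaves two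
    minors: one triangular, the other an identity after one more expansion, along its last row. *)
Lemma det_border_id n (u v : 'I_n.+2 -> R) :
  \det (border u v 1%:M) = u ord0 * v ord_max - v ord0 * u ord_max.
Proof.
rewrite (expand_det_row _ ord0) (bigD1 ord0) //= (bigD1 ord_max) //= big1.
  2: { move=> j /andP[j0 jm]; rewrite mxE (negbTE j0) (negbTE jm) mxE.
       by rewrite eq_sym (negbTE j0) mul0r. }
rewrite addr0 !mxE /= /cofactor.
have -> : \det (row' ord0 (col' ord0 (border u v 1%:M))) = v ord_max.
  rewrite -det_tr det_trig; last first.
    apply/is_trig_mxP; rewrite /= => i j ij; rewrite !mxE.
    have jm : (lift ord0 i == ord_max) = false.
      by apply/negbTE; rewrite -val_eqE /= /bump /=; have := ltn_ord j; lia.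
    rewrite jm /=; case: eqP => // /(congr1 val) /=.
    by rewrite /bump /=; lia.
  rewrite big_ord_recr /= big1 ?mul1r.
    rewrite !mxE /=; have -> : lift ord0 ord_max = ord_max :> 'I_n.+2.
      by apply: val_inj.
    by rewrite eqxx.
  move=> i _; rewrite !mxE /=.
  have -> : (lift ord0 (widen_ord (leqnSn n) i) == ord_max) = false.
    by apply/negbTE; rewrite -val_eqE /= /bump /=; have := ltn_ord i; lia.
  by rewrite eqxx.
have -> : \det (row' ord0 (col' ord_max (border u v 1%:M))) =
          (-1) ^+ n * u ord_max.
  rewrite (expand_det_row _ ord_max) (bigD1 ord0) //= big1.
    2: { move=> j j0; rewrite !mxE.
         have -> : (lift ord_max j == ord0) = false.
           apply/negbTE; rewrite -val_eqE /= /bump; have := j0.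
           by rewrite -val_eqE /=; lia.
         have -> : (lift ord_max j == ord_max) = false.
           by apply/negbTE; rewrite eq_sym neq_lift.
         case: eqP => [/(congr1 val)|]; last by rewrite mul0r.
         by have := ltn_ord j; rewrite /= /bump /=; lia. }
  rewrite addr0 !mxE.
  have -> : lift ord_max ord0 == ord0 :> 'I_n.+2.
    by apply/eqP/val_inj; rewrite /= /bump.
  have -> : lift ord0 ord_max = ord_max :> 'I_n.+2 by apply: val_inj.
  rewrite mulrC /cofactor addn0; congr (_ * _).
  rewrite [X in \det X](_ : _ = 1%:M) ?det1 ?mulr1 //.
  apply/matrixP; rewrite /= => i j; rewrite !mxE.
  have -> : (lift ord_max (lift ord0 j) == ord0) = false.
    by apply/negbTE; rewrite -val_eqE /= /bump /=; lia.
  have -> : (lift ord_max (lift ord0 j) == ord_max) = false.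
    by apply/negbTE; rewrite eq_sym neq_lift.
  congr (_ %:R); congr nat_of_bool.
  by rewrite -!val_eqE /= /bump /=; have := ltn_ord i; have := ltn_ord j; lia.
rewrite !addn0 add0n expr0 mul1r; congr (_ + _).
rewrite eqxx [X in _ * X]mulrA -exprD /= addSn exprS addnn -mul2n exprM.
rewrite sqrrN !expr1n.
ring.
Qed.

(** With [c = \det A] this is the product formed in the condensation proof. Its extreme columns are
    multiples of unit vectors, so two expansions leave the inner minor. *)
Lemma det_border_scalar n (c : R) (A : 'M[R]_n.+2) :
  \det (border (fun i => c *+ (i == ord0)) (fun i => c *+ (i == ord_max)) A)
  = c ^+ 2 * \det (\matrix_(i < n, j < n)
       A (lift ord0 (widen_ord (leqnSn n) i))
         (lift ord0 (widen_ord (leqnSn n) j))).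
Proof.
rewrite (expand_det_col _ ord0) (bigD1 ord0) //= big1 ?addr0; last first.
  by move=> i i0; rewrite mxE /= (negbTE i0) mul0r.
rewrite mxE /= /cofactor expr0 mul1r expr2 -mulrA; congr (_ * _).
rewrite (expand_det_col _ ord_max) (bigD1 ord_max) //= big1 ?addr0; last first.
  rewrite /= => i im; rewrite !mxE /=.
  have -> : lift ord0 ord_max = ord_max :> 'I_n.+2 by apply: val_inj.
  rewrite eqxx /=; case: eqP; last by rewrite mul0r.
  move/(congr1 val) => /= E; case/eqP: im; apply: val_inj.
  by move: E; rewrite /= /bump /=; lia.
rewrite !mxE /=.
have -> : lift ord0 ord_max = ord_max :> 'I_n.+2 by apply: val_inj.
rewrite eqxx /= /cofactor addnn -mul2n exprM sqrrN expr1n expr1n mul1r.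
congr (_ * \det _); apply/matrixP; rewrite /= => i j; rewrite !mxE.
have E (k : 'I_n) : lift ord_max k = widen_ord (leqnSn n) k :> 'I_n.+1.
  by apply: val_inj; rewrite /= /bump; have := ltn_ord k; lia.
rewrite !E; set k := lift ord0 (widen_ord _ j).
have -> : (k == ord0) = false by [].
have -> // : (k == ord_max) = false.
by apply/negbTE; rewrite -val_eqE /= /bump; have := ltn_ord j; lia.
Qed.

(* Multiply [A] by the identity matrix in which the extreme columns are
   replaced by those of the adjugate. *)
Lemma det_condensation n (A : 'M[R]_n.+2) :
  \det A * (cofactor A ord0 ord0 * cofactor A ord_max ord_max
            - cofactor A ord_max ord0 * cofactor A ord0 ord_max) =
  \det A * (\det A * \det (\matrix_(i < n, j < n)
       A (lift ord0 (widen_ord (leqnSn n) i))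
         (lift ord0 (widen_ord (leqnSn n) j)))).
Proof.
rewrite [RHS]mulrA -expr2 -det_border_scalar.
have := det_border_id (fun i => \adj A i ord0) (fun i => \adj A i ord_max).
rewrite ![\adj A _ _]mxE => <-.
rewrite -det_mulmx; congr (\det _); apply/matrixP=> i j.
rewrite [LHS]mxE [RHS]mxE.
have E k : \sum_j A i j * \adj A j k = \det A *+ (i == k).
  have := congr1 (fun M : 'M_n.+2 => M i k) (mul_mx_adj A).
  by rewrite !mxE.
case: (eqVneq j ord0) => [->|j0].
  by rewrite -E; apply: eq_bigr => k _; rewrite [X in _ * X]mxE eqxx.
case: (eqVneq j ord_max) => [->|jm].
  rewrite -E; apply: eq_bigr => k _; rewrite [X in _ * X]mxE eqxx.
  by rewrite (negbTE (ord_max_neq0 n)).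
rewrite (bigD1 j) //= big1 ?addr0.
  by rewrite [X in _ * X]mxE (negbTE j0) (negbTE jm) mxE eqxx mulr1.
move=> k kj; rewrite [X in _ * X]mxE (negbTE j0) (negbTE jm) mxE.
by rewrite (negbTE kj) mulr0.
Qed.

End Condensation.

(* Replacing [A] by ['X - A] makes the determinant regular, so that it can be
   cancelled before specializing at [0]. *)
Lemma det_desnanot (R : idomainType) n (A : 'M[R]_n.+2) :
  \det A * \det (\matrix_(i < n, j < n)
       A (lift ord0 (widen_ord (leqnSn n) i))
         (lift ord0 (widen_ord (leqnSn n) j))) =
  cofactor A ord0 ord0 * cofactor A ord_max ord_max
  - cofactor A ord_max ord0 * cofactor A ord0 ord_max.
Proof.
(* The characteristic matrix of [- A] is ['X + A]: its determinant is monic, and its value at 0 is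
   [A]. *)
pose B := char_poly_mx (- A).
have B0 : \det B != 0 by apply/monic_neq0/char_poly_monic.
have := mulfI B0 (det_condensation B) => /esym/(congr1 (fun p => p.[0])).
have E : map_mx (horner_eval (0 : R)) B = A.
  apply/matrixP; rewrite /= => i j.
  rewrite !mxE /horner_eval hornerD hornerMn hornerX.
  by rewrite mul0rn add0r hornerN hornerC opprK.
have Ec i j : (cofactor B i j).[0] = cofactor A i j.
  by rewrite -[LHS]/(horner_eval (0 : R) _) -cofactor_map_mx E.
rewrite hornerM hornerD hornerN (hornerM (cofactor B ord0 ord0))
  (hornerM (cofactor B ord_max ord0)) !Ec => <-.
congr (_ * _).
  by rewrite -[RHS]/(horner_eval (0 : R) _) -det_map_mx E.
rewrite -[RHS]/(horner_eval (0 : R) _) -det_map_mx; congr (\det _).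
by apply/matrixP; rewrite /= => i j; rewrite -{1}E !mxE.
Qed.

Lemma wdet_condensation (R : idomainType) (f : nat -> nat -> R) n x y :
  wdet f n.+2 x y * wdet f n x.+1 y.+1 =
  wdet f n.+1 x.+1 y.+1 * wdet f n.+1 x y
  - wdet f n.+1 x y.+1 * wdet f n.+1 x.+1 y.
Proof.
have := det_desnanot (\matrix_(i < n.+2, j < n.+2) f (x + i)%N (y + j)%N).
rewrite -/(wdet f n.+2 x y) /cofactor /=.
rewrite [X in _ * X](_ : _ = wdet f n x.+1 y.+1); last first.
  congr (\det _); apply/matrixP; rewrite /= => i j; rewrite !mxE /= /bump /=.
  by congr (f _ _); lia.
rewrite [\det (row' ord0 (col' ord0 _))](_ : _ = wdet f n.+1 x.+1 y.+1);
    last first.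
  congr (\det _); apply/matrixP; rewrite /= => i j; rewrite !mxE /= /bump /=.
  by congr (f _ _); lia.
rewrite [\det (row' ord_max (col' ord_max _))](_ : _ = wdet f n.+1 x y);
    last first.
  congr (\det _); apply/matrixP; rewrite /= => i j; rewrite !mxE /= /bump.
  by have := ltn_ord i; have := ltn_ord j => *; congr (f _ _); lia.
rewrite [\det (row' ord_max (col' ord0 _))](_ : _ = wdet f n.+1 x y.+1);
    last first.
  congr (\det _); apply/matrixP; rewrite /= => i j; rewrite !mxE /= /bump.
  by have := ltn_ord i; have := ltn_ord j => *; congr (f _ _); lia.
rewrite [\det (row' ord0 (col' ord_max _))](_ : _ = wdet f n.+1 x.+1 y);
    last first.
  congr (\det _); apply/matrixP; rewrite /= => i j; rewrite !mxE /= /bump.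
  by have := ltn_ord i; have := ltn_ord j => *; congr (f _ _); lia.
move=> ->; rewrite !addn0 !add0n expr0 mul1r.
by rewrite mulrACA -exprD addnn -mul2n exprM sqrrN !expr1n !mul1r.
Qed.

(** * Jacobi-Trudi determinants *)

Lemma det_sum_rows (R : comNzRingType) n (S : finType)
    (P : 'I_n -> pred S) (f : 'I_n -> S -> 'I_n -> R) :
  \det (\matrix_(i, j) \sum_(s | P i s) f i s j) =
  \sum_(g : {ffun 'I_n -> S} | g \in family P)
    \det (\matrix_(i, j) f i (g i) j).
Proof.
rewrite /determinant exchange_big /=; apply: eq_bigr => s _.
rewrite -big_distrr /=; congr (_ * _).
under eq_bigr do rewrite mxE.
rewrite bigA_distr_big_dep /=; apply: eq_bigr => g _.
by apply: eq_bigr => i _; rewrite mxE.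
Qed.

(** Pigeonhole: no permutation sends the [n - k] rows from [k] on into the [n - k - 1] columns
    beyond [k], so every term of the determinant meets a zero. *)
Lemma det_zero_block (R : comNzRingType) n (A : 'M[R]_n) (k : nat) :
    (k < n)%N ->
    (forall i j : 'I_n, (k <= i)%N -> (j <= k)%N -> A i j = 0) ->
  \det A = 0.
Proof.
move=> kn A0; apply: big1 => s _.
have [/existsP[i /andP[ki si]]|/existsPn H] :=
    boolP [exists i : 'I_n, (k <= i)%N && (s i <= k)%N].
  by rewrite (bigD1 i) //= A0 // mul0r mulr0.
have: (#|[set i : 'I_n | (k <= i)%N]| <= #|[set j : 'I_n | (k < j)%N]|)%N.
  rewrite -(card_imset _ (@perm_inj _ s)); apply: subset_leq_card.
  apply/subsetP=> y /imsetP[i]; rewrite inE => ki ->.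
  by rewrite inE; have := H i; rewrite ki /= -ltnNge.
rewrite leqNgt => /negP[]; apply: proper_card; apply/properP; split.
  by apply/subsetP=> i; rewrite !inE => /ltnW.
by exists (Ordinal kn); rewrite !inE /= ?leqnn ?ltnn.
Qed.

Section JacobiTrudi.

Variables (R : comNzRingType) (q : R).

(* The complete homogeneous symmetric polynomial [h_k] at [1, q, ..., q^(M-1)]. *)
Fixpoint chom (M k : nat) : R :=
  if M is M'.+1 then \sum_(s < k.+1) q ^+ (M' * (k - s)) * chom M' s
  else (k == 0)%:R.

Definition chomz M (z : int) : R := if z is Posz k then chom M k else 0.

Lemma chomz_neg M (z : int) : (z < 0)%R -> chomz M z = 0.
Proof. by case: z. Qed.

Lemma chomzS M (z : int) :
  chomz M.+1 z = chomz M z + q ^+ M * chomz M.+1 (z - 1).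
Proof.
case: z => [[|k]|k].
- by rewrite /= big_ord_recl big_ord0 muln0 addr0 mul1r mulr0 addr0.
- have -> : Posz k.+1 - 1 = Posz k by lia.
  rewrite /= big_ord_recr /= subnn muln0 mul1r addrC; congr (_ + _).
  rewrite mulr_sumr; apply: eq_bigr => s _; rewrite mulrA -exprD.
  by congr (_ ^+ _ * _); have := ltn_ord s; nia.
- by rewrite ![chomz _ _]chomz_neg ?mulr0 ?addr0 //; lia.
Qed.

(** Iterates [chomzS] down from [b] to [a]. The leftover term is a multiple of an entry of the next
    row of the Jacobi-Trudi matrix when [a] and [b] are consecutive parts. *)
Lemma chomz_sum M (a b : nat) (y : int) : (a <= b)%N ->
  chomz M.+1 (b%:Z + y) =
  \sum_(a <= s < b.+1) q ^+ (M * (b - s)) * chomz M (s%:Z + y)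
  + q ^+ (M * (b - a).+1) * chomz M.+1 (a%:Z + y - 1).
Proof.
elim: b => [|b IHb] ab.
  have -> : a = 0%N by lia.
  by rewrite big_nat1 subnn muln0 mul1r muln1 chomzS.
have [->|ab'] := eqVneq a b.+1.
  by rewrite big_nat1 subnn muln0 mul1r muln1 chomzS.
have {}ab : (a <= b)%N by lia.
rewrite chomzS; have -> : b.+1%:Z + y - 1 = b%:Z + y by lia.
rewrite IHb // [in RHS]big_nat_recr /=; last by lia.
rewrite subnn muln0 mul1r mulrDr mulr_sumr.
rewrite addrA [X in X + _]addrC; congr (_ + _ + _).
  apply: eq_big_nat => s /andP[_ sb]; rewrite mulrA -exprD.
  by congr (_ ^+ _ * _); nia.
by rewrite mulrA -exprD; congr (_ ^+ _ * _); nia.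
Qed.

Variable r : nat.

Definition jtdet M (lam mu : nat -> nat) : R :=
  \det (\matrix_(i < r, j < r)
          chomz M ((lam i)%:Z - i%:Z - (mu j)%:Z + j%:Z)).

Lemma antitone_le (f : nat -> nat) i j :
  (forall i, f i.+1 <= f i)%N -> (i <= j)%N -> (f j <= f i)%N.
Proof.
move=> fd /subnK <-; elim: (j - i)%N => // k IH.
by apply: leq_trans IH; apply: fd.
Qed.

(** From row [k] on, all entries in the columns up to [k] have negative degree. *)
Lemma jtdet_vanish M lam mu k :
    (forall i, lam i.+1 <= lam i)%N -> (forall i, mu i.+1 <= mu i)%N ->
    (k < r)%N -> (lam k < mu k)%N ->
  jtdet M lam mu = 0.
Proof.
move=> ld md kr lk; apply: (det_zero_block kr) => i j ki jk.
rewrite mxE chomz_neg //.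
by have := antitone_le ld ki; have := antitone_le md jk; lia.
Qed.

(** Without variables only degree 0 survives. Above the diagonal all degrees are positive, so the
    determinant is the product of the diagonal tests [lam i = mu i]. *)
Lemma jtdet0 lam mu :
    (forall i, lam i.+1 <= lam i)%N -> (forall i, mu i.+1 <= mu i)%N ->
    (forall i, (i < r)%N -> mu i <= lam i)%N ->
  jtdet 0 lam mu = [forall i : 'I_r, lam i <= mu i]%N%:R.
Proof.
move=> ld md ml; rewrite /jtdet det_trig; last first.
  apply/is_trig_mxP => i j ij; rewrite mxE.
  have := ml i (ltn_ord i); have := antitone_le md (ltnW ij) => H1 H2.
  set z := (X in chomz _ X); have : (0 < z)%R by rewrite /z; lia.
  by case: z => [[]|].
transitivity (\prod_(i < r) (lam i <= mu i)%N%:R : R).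
  apply: eq_bigr => i _; rewrite mxE.
  have := ml i (ltn_ord i); case: (leqP (lam i)) => H H'.
    by have -> : (lam i)%:Z - i%:Z - (mu i)%:Z + i%:Z = 0 by lia.
  set z := (X in chomz _ X); have : (0 < z)%R by rewrite /z; lia.
  by case: z => [[]|].
have [/forallP H|/forallPn[i H]] := boolP [forall i : 'I_r, lam i <= mu i]%N.
  by apply: big1 => i _; rewrite H.
by rewrite (bigD1 i) //= (negbTE H) mul0r.
Qed.

(* Subtracting from each row a multiple of the next one turns the rows into
   sums over disjoint intervals. *)
Lemma jtdet_diff M lam mu :
    (forall i, lam i.+1 <= lam i)%N -> lam r = 0%N ->
  jtdet M.+1 lam mu =
  \det (\matrix_(i < r, j < r)
     \sum_(lam i.+1 <= s < (lam i).+1)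
       q ^+ (M * (lam i - s)) * chomz M (s%:Z - i%:Z - (mu j)%:Z + j%:Z)).
Proof.
move=> ld lr.
(* The row operation as a unitriangular matrix; its superdiagonal holds the coefficients of the
   leftover terms in [chomz_sum]. *)
pose U : 'M[R]_r := \matrix_(i, k) ((i == k)%:R
   - q ^+ (M * (lam i - lam i.+1).+1) * (k == i.+1 :> nat)%:R).
have dU : \det U = 1.
  rewrite -det_tr det_trig; last first.
    apply/is_trig_mxP => i j ij; rewrite !mxE.
    have -> : (j == i) = false by apply/negbTE; rewrite -val_eqE /=; lia.
    have -> : (i == j.+1 :> nat) = false by lia.
    by rewrite mulr0 subr0.
  apply: big1 => i _; rewrite !mxE eqxx.
  by have -> : (i == i.+1 :> nat) = false; [lia | rewrite mulr0 subr0].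
rewrite /jtdet -[LHS]mul1r -dU -det_mulmx; congr (\det _).
apply/matrixP=> i j; rewrite !mxE.
set y := (- i%:Z - (mu j)%:Z + j%:Z).
have -> : \sum_(lam i.+1 <= s < (lam i).+1)
       q ^+ (M * (lam i - s)) * chomz M (s%:Z - i%:Z - (mu j)%:Z + j%:Z) =
   chomz M.+1 ((lam i)%:Z + y)
   - q ^+ (M * (lam i - lam i.+1).+1) * chomz M.+1 ((lam i.+1)%:Z + y - 1).
  rewrite (chomz_sum _ _ (ld i)) addrK; apply: eq_bigr => s _.
  by congr (_ * chomz _ _); rewrite /y; lia.
under eq_bigr => k _ do rewrite !mxE mulrBl -mulrA.
rewrite big_split /= sumrN -mulr_sumr; congr (_ - _ * _).
  rewrite (bigD1 i) //= big1 ?addr0 ?eqxx ?mul1r => [|k ki].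
    by congr (chomz _ _); rewrite /y; lia.
  by rewrite eq_sym (negbTE ki) mul0r.
have [ir|ir] := ltnP i.+1 r.
  rewrite (bigD1 (Ordinal ir)) //= big1 ?addr0 ?eqxx ?mul1r => [|k ki].
    by congr (chomz _ _); rewrite /y; lia.
  suff -> : (k == i.+1 :> nat) = false by rewrite mul0r.
  by apply/negbTE; move: ki; rewrite -val_eqE.
(* The last row has no successor, but [lam r = 0] makes the degree of its leftover term negative. *)
have eir : i.+1 = r by have := ltn_ord i; lia.
rewrite chomz_neg; last by rewrite /y eir lr; have := ltn_ord j; lia.
apply: big1 => k _; suff -> : (k == i.+1 :> nat) = false by rewrite mul0r.
by have := ltn_ord k; lia.
Qed.

Variable K : nat.
Implicit Type nu : {ffun 'I_r -> 'I_K.+1}.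

(** Interlacing partitions are summed over as finite functions; extension by 0 makes them sequences
    to which [jtdet] applies again. *)
Definition ffun_part nu (i : nat) : nat :=
  if insub i is Some o then nu o else 0%N.

Lemma ffun_partE nu (i : 'I_r) : ffun_part nu i = nu i.
Proof. by rewrite /ffun_part valK. Qed.

Lemma ffun_part_out nu i : (r <= i)%N -> ffun_part nu i = 0%N.
Proof. by move=> ri; rewrite /ffun_part insubN // -leqNgt. Qed.

(** This says that [lam / nu] is a horizontal strip. *)
Definition interlace (lam : nat -> nat) nu : bool :=
  [forall i : 'I_r, lam i.+1 <= nu i <= lam i]%N.

Lemma interlace_antitone lam nu :
  (forall i, lam i.+1 <= lam i)%N -> interlace lam nu ->
  forall i, (ffun_part nu i.+1 <= ffun_part nu i)%N.
Proof.
move=> ld /forallP H i; have [ir|ir] := ltnP i.+1 r; last first.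
  by rewrite ffun_part_out.
have := ffun_partE nu (Ordinal (ltnW ir)); have := ffun_partE nu (Ordinal ir).
rewrite /= => -> ->; have := H (Ordinal ir); have := H (Ordinal (ltnW ir)).
by rewrite /=; lia.
Qed.

(** By multilinearity, choosing one summand in each row of [jtdet_diff] means choosing an
    interlacing [nu]; the powers of [q] come out as a diagonal matrix. *)
Lemma jtdetS M lam mu :
    (forall i, lam i.+1 <= lam i)%N -> lam r = 0%N ->
    (forall i, lam i <= K)%N ->
  jtdet M.+1 lam mu = \sum_(nu | interlace lam nu)
    q ^+ (M * \sum_(i < r) (lam i - nu i)) * jtdet M (ffun_part nu) mu.
Proof.
move=> ld lr lK; rewrite jtdet_diff //.
pose P (i : 'I_r) := [pred s : 'I_K.+1 | (lam i.+1 <= s <= lam i)%N].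
transitivity (\det (\matrix_(i < r, j < r) \sum_(s : 'I_K.+1 | P i s)
     q ^+ (M * (lam i - s)) * chomz M (s%:Z - i%:Z - (mu j)%:Z + j%:Z))).
  congr (\det _); apply/matrixP=> i j; rewrite !mxE.
  rewrite (big_nat_widen _ _ K.+1) ?ltnS ?lK //.
  rewrite (big_nat_widenl _ 0) // big_mkord; apply: eq_bigl => s /=.
  by rewrite ltnS andbC.
rewrite det_sum_rows; apply: eq_big => [nu|nu _].
  by apply/familyP/forallP => H i; have := H i; rewrite ?inE.
rewrite [(M * _)%N]big_distrr /= -prodrXr /jtdet.
pose dg : 'rV[R]_r := \row_i q ^+ (M * (lam i - nu i)).
rewrite [X in X * _](_ : _ = \det (diag_mx dg)); last first.
  by rewrite det_diag; apply: eq_bigr => i _; rewrite mxE.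
rewrite -det_mulmx; congr (\det _); apply/matrixP=> i j.
by rewrite mul_diag_mx !mxE ffun_partE.
Qed.

End JacobiTrudi.

(** * Tableaux in a box *)

Section BoxTableaux.

Variables (R : comNzRingType) (q : R) (r K N : nat).

Local Notation box := ('I_r * 'I_K)%type.
Local Notation filling := {ffun box -> 'I_N.+1}.
Implicit Types (lam mu : nat -> nat) (T : filling) (x : box).
Implicit Type nu : {ffun 'I_r -> 'I_K.+1}.

Definition in_shape lam mu x : bool := (mu x.1 <= x.2 < lam x.1)%N.

(* Tableaux of shape [lam / mu] with entries less than [M], extended by [0] to
   the whole box; rows and columns are numbered from [0]. *)
Definition box_tableau M lam mu T : bool :=
  [&& [forall x,
         if in_shape lam mu x then (T x < M)%N else (T x == 0 :> nat)%N],
      [forall i, [forall j, [forall j',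
        [&& in_shape lam mu (i, j), in_shape lam mu (i, j') & (j < j')%N]
        ==> (T (i, j) <= T (i, j'))%N]]]
    & [forall j, [forall i, [forall i',
        [&& in_shape lam mu (i, j), in_shape lam mu (i', j) & (i < i')%N]
        ==> (T (i, j) < T (i', j))%N]]]].

Variant box_tableau_spec M lam mu T : Prop :=
  BoxTableau of
    (forall x, in_shape lam mu x -> (T x < M)%N) &
    (forall x, ~~ in_shape lam mu x -> T x = 0 :> nat) &
    (forall i j j', in_shape lam mu (i, j) -> in_shape lam mu (i, j') ->
       (j < j')%N -> (T (i, j) <= T (i, j'))%N) &
    (forall j i i', in_shape lam mu (i, j) -> in_shape lam mu (i', j) ->
       (i < i')%N -> (T (i, j) < T (i', j))%N).

Lemma box_tableauP M lam mu T :
  reflect (box_tableau_spec M lam mu T) (box_tableau M lam mu T).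
Proof.
apply: (iffP and3P) => [[/forallP H1 /forallP H2 /forallP H3]|[H1 H2 H3 H4]].
  split.
  - by move=> x xs; have := H1 x; rewrite xs.
  - by move=> x xs; have := H1 x; rewrite (negbTE xs) => /eqP.
  - move=> i j j' s s' jj; have /forallP/(_ j)/forallP/(_ j') := H2 i.
    by rewrite s s' jj.
  - move=> j i i' s s' jj; have /forallP/(_ i)/forallP/(_ i') := H3 j.
    by rewrite s s' jj.
split.
- by apply/forallP=> x; case: ifPn => [/H1|/H2 ->].
- apply/forallP=> i; apply/forallP=> j; apply/forallP=> j'.
  by apply/implyP=> /and3P[]; apply: H3.
- apply/forallP=> i; apply/forallP=> j; apply/forallP=> j'.
  by apply/implyP=> /and3P[]; apply: H4.
Qed.

Definition box_sum M lam mu : R :=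
  \sum_(T : filling | box_tableau M lam mu T) q ^+ (\sum_x T x)%N.

Lemma box_sum0 lam mu :
  box_sum 0 lam mu = [forall i : 'I_r, [forall j : 'I_K,
                        ~~ in_shape lam mu (i, j)]]%:R.
Proof.
have [/forallP H|/forallPn[i /forallPn[j]]] :=
  boolP [forall i : 'I_r, [forall j : 'I_K, ~~ in_shape lam mu (i, j)]];
  last first.
  rewrite negbK => ij; apply: big_pred0 => T.
  apply/negP=> /box_tableauP[H1 _ _ _].
  by have := H1 _ ij.
have Hs x : in_shape lam mu x = false.
  by apply/negbTE; case: x => i j; have /forallP := H i; apply.
rewrite /box_sum (big_pred1 [ffun=> ord0]); last first.
  move=> T; apply/box_tableauP/eqP => [[_ H0 _ _]|->].
    by apply/ffunP=> x; rewrite ffunE; apply: val_inj; rewrite /= H0 ?Hs.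
  split=> [x|x _|i j j'|j i i']; rewrite ?Hs //.
  by rewrite ffunE.
by rewrite big1 ?expr0 // => x _; rewrite ffunE.
Qed.

Definition cut M lam mu T : {ffun 'I_r -> 'I_K.+1} :=
  [ffun i : 'I_r => inord (maxn (mu i)
     (\max_(j < K | in_shape lam mu (i, j) && (T (i, j) < M)%N) j.+1))].

Definition glue M lam nu T : filling :=
  [ffun x : box => if (nu x.1 <= x.2 < lam x.1)%N then inord M else T x].

Definition restrict nu T : filling :=
  [ffun x : box => if (x.2 < nu x.1)%N then T x else ord0].

(** * Removal of the largest letter [M] *)

Section Step.

Variables (M : nat) (lam mu : nat -> nat).
Hypothesis MN : (M <= N)%N.
Hypothesis ld : forall i, (lam i.+1 <= lam i)%N.
Hypothesis lr : lam r = 0%N.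
Hypothesis md : forall i, (mu i.+1 <= mu i)%N.
Hypothesis ml : forall i, (i < r)%N -> (mu i <= lam i)%N.
Hypothesis lK : forall i, (lam i <= K)%N.

(** Characterizes the shape of [mu] together with the letters below [M], without the maximum in
    [cut]; by uniqueness it identifies the cut of a glued tableau. *)
Definition cuts T nu : Prop :=
  (forall i : 'I_r, mu i <= nu i <= lam i)%N /\
  (forall x, in_shape lam mu x -> (T x < M)%N = (x.2 < nu x.1)%N).

Lemma cuts_unique T nu nu' : cuts T nu -> cuts T nu' -> nu = nu'.
Proof.
move=> [b1 c1] [b2 c2]; apply/ffunP=> i; apply: val_inj => /=.
have H j : (mu i <= j < lam i)%N -> (j < nu i)%N = (j < nu' i)%N.
  move=> jb; have jK : (j < K)%N by have := lK i; lia.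
  by rewrite -(c1 (i, Ordinal jK)) // -(c2 (i, Ordinal jK)).
have := b1 i; have := b2 i; have := H (nu i); have := H (nu' i).
by rewrite !ltnn; lia.
Qed.

(** Rows increase weakly, so the letters below [M] fill an initial segment of each row of the skew
    shape. *)
Lemma cut_cuts T : box_tableau M.+1 lam mu T -> cuts T (cut M lam mu T).
Proof.
move=> /box_tableauP[_ _ H3 _].
have bm i : (\max_(j < K | in_shape lam mu (i, j) && (T (i, j) < M)%N) j.+1
             <= lam i)%N.
  by apply/bigmax_leqP=> j /andP[/andP[_]].
have E i : cut M lam mu T i = maxn (mu i)
    (\max_(j < K | in_shape lam mu (i, j) && (T (i, j) < M)%N) j.+1) :> nat.
  rewrite ffunE inordK //; have := bm i; have := lK i.
  by have := ml (ltn_ord i); lia.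
split=> [i|[i j] ij].
  by rewrite E leq_maxl geq_max ml //= bm.
rewrite E /=; apply/idP/idP => [Tij|].
  rewrite leq_max; apply/orP; right.
  by rewrite (bigmax_sup j) // ij Tij.
rewrite leq_max => /orP[H|H]; first by move: ij; rewrite /in_shape /=; lia.
have [/existsP[j' /and3P[s t jj]]|/existsPn Hn] := boolP [exists j' : 'I_K,
    [&& in_shape lam mu (i, j'), (T (i, j') < M)%N & (j <= j')%N]].
  move: jj; rewrite leq_eqVlt => /orP[/eqP/val_inj->//|jj].
  exact: leq_ltn_trans (H3 _ _ _ ij s jj) t.
move: H; rewrite ltnNge => /negP[]; apply/bigmax_leqP => j' /andP[s t].
by have := Hn j'; rewrite s t /= -ltnNge.
Qed.

(** Otherwise the column of the first removed cell of row [i] would contain two letters [M], one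
    below the other, against strictness. *)
Lemma cut_interlace T : box_tableau M.+1 lam mu T ->
  interlace lam (cut M lam mu T).
Proof.
move=> tT; have [cb cx] := cut_cuts tT; have /box_tableauP[H1 _ _ H4] := tT.
apply/forallP=> i; have := cb i => /andP[b1 ->]; rewrite andbT.
rewrite leqNgt; apply/negP=> lt.
have := lK i.+1 => lKi; set c := nat_of_ord (cut _ _ _ _ i) in lt b1.
have cK : (c < K)%N by lia.
have ir : (i.+1 < r)%N.
  by rewrite ltn_neqAle ltn_ord andbT; apply: contraTneq lt => ->; rewrite lr.
pose j := Ordinal cK.
have s1 : in_shape lam mu (i, j).
  by rewrite /in_shape /= b1 /=; have := ld i; lia.
have s2 : in_shape lam mu (Ordinal ir, j).
  by rewrite /in_shape /= lt andbT; have := md i; lia.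
have := H4 j i (Ordinal ir) s1 s2 (leqnn _); have := H1 _ s2.
by have := cx _ s1; rewrite /= -/c ltnn; lia.
Qed.

Variable nu : {ffun 'I_r -> 'I_K.+1}.
Hypothesis nul : interlace lam nu.
Hypothesis mnu : forall i : 'I_r, (mu i <= nu i)%N.

Let np := ffun_part nu.

Lemma in_shape_part x : in_shape np mu x = (mu x.1 <= x.2 < nu x.1)%N.
Proof. by rewrite /in_shape /np ffun_partE. Qed.

Lemma nu_le i : (nu i <= lam i)%N.
Proof. by have /forallP/(_ i)/andP[] := nul. Qed.

Lemma glue_val T x :
  glue M lam nu T x = (if (nu x.1 <= x.2 < lam x.1)%N then M else T x) :> nat.
Proof. by rewrite ffunE; case: ifP; rewrite ?inordK. Qed.

Lemma glue_cuts T : box_tableau M np mu T -> cuts (glue M lam nu T) nu.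
Proof.
move=> /box_tableauP[H1 _ _ _]; split=> [i|x xs].
  by rewrite mnu nu_le.
rewrite glue_val; have := xs; rewrite /in_shape => /andP[b1 b2].
have := H1 x; rewrite in_shape_part b1 b2 andbT /= => H.
by case: ltnP H => [_ ->|_ _] //; rewrite ltnn.
Qed.

Lemma glue_tableau T : box_tableau M np mu T ->
  box_tableau M.+1 lam mu (glue M lam nu T).
Proof.
move=> tT; have [_ c2] := glue_cuts tT.
have /box_tableauP[H1 H2 H3 H4] := tT; apply/box_tableauP; split.
- move=> x xs; rewrite glue_val; case: ifP => // H.
  apply: ltnW; rewrite ltnS; apply: H1.
  by move: H xs; rewrite in_shape_part /in_shape; lia.
- move=> x xs; rewrite glue_val; case: ifP => H.
    by move: H xs (mnu x.1); rewrite /in_shape; lia.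
  apply: H2; move: H xs (mnu x.1) (nu_le x.1).
  by rewrite in_shape_part /in_shape; lia.
- move=> i j j' s s' jj; rewrite !glue_val /=.
  have Sh k : in_shape lam mu (i, k) -> (k < nu i)%N -> in_shape np mu (i, k).
    by rewrite in_shape_part /in_shape /=; lia.
  have l1 : (j < lam i)%N by case/andP: s.
  have l2 : (j' < lam i)%N by case/andP: s'.
  rewrite l1 l2 !andbT.
  case: (leqP (nu i) j) => c1; case: (leqP (nu i) j') => c3 //.
    by move: c1 c3; lia.
    by apply: ltnW; apply: H1; apply: Sh.
  by apply: H3 => //; apply: Sh.
- move=> j i i' s s' ii; rewrite !glue_val /=.
  have Sh k : in_shape lam mu (k, j) -> (j < nu k)%N -> in_shape np mu (k, j).
    by rewrite in_shape_part /in_shape /=; lia.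
  have l1 : (j < lam i)%N by case/andP: s.
  have l2 : (j < lam i')%N by case/andP: s'.
  (* By interlacing, [lam i' <= lam i.+1 <= nu i]: the upper cell lies outside the strip. *)
  have l3 : (j < nu i)%N.
    have /forallP/(_ i)/andP[l3 _] := nul.
    by have := antitone_le ld ii; lia.
  rewrite l1 l2 !andbT (ltn_geF l3); case: (leqP (nu i') j) => c3.
    by apply: H1; apply: Sh.
  by apply: H4 => //; apply: Sh.
Qed.

Lemma restrict_glue T : box_tableau M np mu T ->
  restrict nu (glue M lam nu T) = T.
Proof.
move=> /box_tableauP[_ H2 _ _]; apply/ffunP=> x; apply: val_inj.
rewrite ffunE; case: ltnP => H.
  by rewrite /= glue_val leqNgt H.
by rewrite /= H2 // in_shape_part ltnNge H andbF.
Qed.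

Lemma glue_restrict T : box_tableau M.+1 lam mu T -> cuts T nu ->
  glue M lam nu (restrict nu T) = T.
Proof.
move=> /box_tableauP[H1 H2 _ _] [c1 c2]; apply/ffunP=> -[i j]; apply: val_inj.
rewrite /= glue_val /=; case: ifP => H.
  have xs : in_shape lam mu (i, j).
    by move: H (mnu i); rewrite /in_shape /=; lia.
  have := H1 _ xs; case/andP: H => H _.
  by have := c2 _ xs; rewrite [RHS]ltnNge H /=; lia.
rewrite ffunE /=; case: ltnP => // H'; rewrite /= H2 //.
by move: H H' (mnu i); rewrite /in_shape /=; lia.
Qed.

Lemma restrict_tableau T : box_tableau M.+1 lam mu T -> cuts T nu ->
  box_tableau M np mu (restrict nu T).
Proof.
move=> /box_tableauP[H1 H2 H3 H4] [c1 c2].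
have Sh x : in_shape np mu x -> in_shape lam mu x.
  by rewrite in_shape_part /in_shape; have := nu_le x.1; lia.
have Re x : in_shape np mu x -> restrict nu T x = T x.
  by rewrite in_shape_part ffunE => /andP[_ ->].
apply/box_tableauP; split.
- move=> x xs; rewrite Re // c2 ?Sh //.
  by move: xs; rewrite in_shape_part => /andP[].
- move=> x; rewrite in_shape_part ffunE; case: ltnP => //= H.
  rewrite andbT => xs; apply: H2; apply: contra xs.
  by rewrite /in_shape => /andP[].
- by move=> i j j' s s' jj; rewrite !Re //; apply: H3; rewrite ?Sh.
- by move=> i j j' s s' jj; rewrite !Re //; apply: H4; rewrite ?Sh.
Qed.

(** Outside its shape [T] is 0, so each cell of the strip gains exactly [M]. *)
Lemma glue_weight T : box_tableau M np mu T ->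
  (\sum_x glue M lam nu T x =
   \sum_x T x + M * \sum_(i < r) (lam i - nu i))%N.
Proof.
move=> /box_tableauP[_ H2 _ _].
transitivity (\sum_(x : box) (T x + M * (nu x.1 <= x.2 < lam x.1)))%N.
  apply: eq_bigr => x _; rewrite glue_val; case: ifP => H; last first.
    by rewrite muln0 addn0.
  by rewrite H2 ?muln1 // in_shape_part; move: H; lia.
rewrite big_split /=; congr (_ + _)%N; rewrite -big_distrr /=.
congr (_ * _)%N; rewrite -(pair_big xpredT xpredT
  (fun (i : 'I_r) (j : 'I_K) => nat_of_bool (nu i <= j < lam i)%N)) /=.
apply: eq_bigr => i _.
rewrite -(big_mkord xpredT (fun j => nat_of_bool (nu i <= j < lam i)%N)).
rewrite -[RHS]muln1 -sum_nat_const_nat [RHS](big_nat_widen _ _ K) //.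
rewrite [RHS](big_nat_widenl _ 0) // [RHS]big_mkcond /=.
by apply: eq_big_nat => j _; rewrite andbC; case: ifP.
Qed.

End Step.

(** Tableaux are grouped by the shape left after removing the letter [M]; within a group, [glue] and
    [restrict] are inverse bijections. *)
Lemma box_sumS M lam mu :
    (M <= N)%N -> (forall i, lam i.+1 <= lam i)%N -> lam r = 0%N ->
    (forall i, mu i.+1 <= mu i)%N ->
    (forall i, (i < r)%N -> (mu i <= lam i)%N) ->
    (forall i, lam i <= K)%N ->
  box_sum M.+1 lam mu =
  \sum_(nu : {ffun 'I_r -> 'I_K.+1} |
          interlace lam nu && [forall i : 'I_r, (mu i <= nu i)%N])
    q ^+ (M * \sum_(i < r) (lam i - nu i)) * box_sum M (ffun_part nu) mu.
Proof.
move=> MN ld lr md ml lK; rewrite /box_sum.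
rewrite (partition_big (cut M lam mu)
  (fun nu => interlace lam nu && [forall i : 'I_r, (mu i <= nu i)%N])) /=;
    last first.
  move=> T tT; rewrite cut_interlace //=; apply/forallP=> i.
  by have [/(_ i)/andP[]] := cut_cuts MN lr ml lK tT.
apply: eq_bigr => nu /andP[nul /forallP mnu].
rewrite (reindex_onto (glue M lam nu) (restrict nu)) /=; last first.
  move=> T /andP[tT /eqP E]; apply: (glue_restrict MN lr nul mnu tT).
  by rewrite -E; apply: cut_cuts.
rewrite mulr_sumr; apply: eq_big => [T|T].
  apply/idP/idP => [/andP[/andP[tT /eqP E] /eqP <-]|tT].
    apply: (restrict_tableau MN lr nul tT).
    by rewrite -{2}E; apply: cut_cuts.
  rewrite glue_tableau // (restrict_glue lam MN tT) // eqxx andbT; apply/eqP.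
  apply: (cuts_unique MN lr lK (cut_cuts MN lr ml lK _)
                      (glue_cuts MN nul mnu tT)).
  exact: glue_tableau.
case/andP=> /andP[tT /eqP E] /eqP ET.
rewrite (@glue_weight M lam mu) //; last first.
  rewrite -ET; apply: (restrict_tableau MN lr nul tT).
  by rewrite -{2}E; apply: cut_cuts.
by rewrite exprD mulrC.
Qed.

(** Induction on the number of letters. [jtdetS] also runs over those [nu] that do not contain [mu];
    their determinants vanish by [jtdet_vanish]. *)
Theorem jacobi_trudi M lam mu :
    (M <= N.+1)%N -> (forall i, lam i.+1 <= lam i)%N -> lam r = 0%N ->
    (forall i, mu i.+1 <= mu i)%N ->
    (forall i, (i < r)%N -> (mu i <= lam i)%N) ->
    (forall i, lam i <= K)%N ->
  box_sum M lam mu = jtdet q r M lam mu.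
Proof.
elim: M lam => [|M IHM] lam MN ld lr md ml lK.
  rewrite box_sum0 jtdet0 //; congr (_ %:R); congr nat_of_bool.
  apply: eq_forallb => i; apply/forallP/idP => [H|H j]; last first.
    by rewrite /in_shape /=; lia.
  rewrite leqNgt; apply/negP=> lt; have lKi := lK i.
  have mK : (mu i < K)%N by lia.
  by have := H (Ordinal mK); rewrite /in_shape /= leqnn lt.
rewrite box_sumS // (@jtdetS _ _ _ K) //.
rewrite [RHS](bigID (fun nu : {ffun 'I_r -> 'I_K.+1} =>
   [forall i : 'I_r, (mu i <= nu i)%N])) /=.
rewrite [X in _ = _ + X]big1 ?addr0.
  apply: eq_bigr => nu /andP[nul /forallP mnu]; rewrite IHM //.
  - exact: ltnW.
  - exact: interlace_antitone nul.
  - by rewrite ffun_part_out.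
  - by move=> i ir; have := mnu (Ordinal ir); rewrite -ffun_partE.
  - move=> i; have [ir|ir] := ltnP i r; last by rewrite ffun_part_out.
    by have := ffun_partE nu (Ordinal ir); rewrite /= => ->; rewrite -ltnS.
move=> nu /andP[nul /forallPn[i]]; rewrite -ltnNge => H.
rewrite (jtdet_vanish _ _ _ md (ltn_ord i)) ?mulr0 ?ffun_partE //.
exact: interlace_antitone nul.
Qed.

End BoxTableaux.

(** * Closed forms *)

Section ClosedForms.

Variables (K : fieldType) (q : K).
Hypothesis q0 : q != 0.
Hypothesis qX1 : forall k, q ^+ k.+1 != 1.

(** The shift by one keeps [qone] nonzero. Then [qfact k] is $(q;q)_k$, and [qsuper] is its
    superfactorial, in which products over rectangles become quotients. *)
Definition qone k : K := 1 - q ^+ k.+1.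
Definition qfact k : K := \prod_(i < k) qone i.
Definition qsuper k : K := \prod_(i < k) qfact i.

Local Notation u := qone.
Local Notation P := qfact.
Local Notation F := qsuper.

Lemma qone_neq0 k : u k != 0.
Proof. by rewrite subr_eq0 eq_sym qX1. Qed.

Lemma qfact_neq0 k : P k != 0.
Proof. by apply/prodf_neq0 => i _; apply: qone_neq0. Qed.

Lemma qsuper_neq0 k : F k != 0.
Proof. by apply/prodf_neq0 => i _; apply: qfact_neq0. Qed.

Lemma qfactS k : P k.+1 = P k * u k.
Proof. by rewrite /qfact big_ord_recr. Qed.

Lemma qsuperS k : F k.+1 = F k * P k.
Proof. by rewrite /qsuper big_ord_recr. Qed.

Lemma qfact0 : P 0 = 1. Proof. by rewrite /qfact big_ord0. Qed.
Lemma qsuper0 : F 0 = 1. Proof. by rewrite /qsuper big_ord0. Qed.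

(* With [Z = q^z.+1], [W = q^w.+1], [V = q^v.+1] this is the identity
   [V (1 - Z) (1 - W) = (1 - Z V) (1 - W V) - (1 - Z W V) (1 - V)]. *)
Lemma condensation_identity z w v (L A B : K) :
    A * (u z * u w) = L * (u (z + v).+1 * u (w + v).+1) ->
    B * (u z * u w) = L * (u (z + w + v).+2 * u v) ->
  q ^+ v.+1 * L = A - B.
Proof.
move=> eA eB; have zw : u z * u w != 0 by rewrite mulf_neq0 ?qone_neq0.
apply: (mulIf zw); rewrite [RHS]mulrBl eA eB /qone !exprS !exprD; ring.
Qed.

(** The common end of the three inductions: the condensation identity is solved for [D] by dividing
    by the closed form of the inner minor, once both products on the right carry the same power of
    [q]. *)
Lemma condensation_solve v e0 e1 ea ea' eb eb' (D x0 x1 a a' b b' : K) :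
    x1 != 0 ->
    D * (q ^+ e1 * x1) =
      q ^+ ea * a * (q ^+ ea' * a') - q ^+ eb * b * (q ^+ eb' * b') ->
    q ^+ v * (x0 * x1) = a * a' - b * b' ->
    (e0 + e1 = ea + ea' + v)%N -> (ea + ea' = eb + eb')%N ->
  D = q ^+ e0 * x0.
Proof.
move=> nz1 eD ex ee ee'; have nz : q ^+ e1 * x1 != 0.
  by rewrite mulf_neq0 ?expf_neq0.
apply: (mulIf nz); rewrite eD.
rewrite [RHS]mulrACA -exprD ee exprD -[RHS]mulrA ex mulrBr.
by rewrite mulrACA -exprD [X in _ - X]mulrACA -[in X in _ - X]exprD ee'.
Qed.

Lemma chom0 M : chom q M 0 = 1.
Proof.
elim: M => //= M IH; rewrite big_ord_recl big_ord0 muln0 addr0 mul1r.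
by rewrite /= IH.
Qed.

(** The Gaussian binomial coefficient of [M + k] over [k]; [chomzS] is its q-Pascal rule. *)
Lemma chomE M k : chom q M.+1 k = P (M + k) / (P M * P k).
Proof.
elim: M k => [|M IHM].
  elim=> [|k IHk]; first by rewrite chom0 !qfact0 mulr1 divr1.
  have := chomzS q 0 k.+1; rewrite /chomz.
  have -> : Posz k.+1 - 1 = Posz k by lia.
  rewrite IHk /= => ->; rewrite add0r mul1r !add0n qfact0 !mul1r.
  by rewrite !divff ?qfact_neq0.
elim=> [|k IHk].
  by rewrite chom0 qfact0 addn0 mulr1 divff ?qfact_neq0.
have := chomzS q M.+1 k.+1; rewrite /chomz.
have -> : Posz k.+1 - 1 = Posz k by lia.
move=> ->; rewrite IHk IHM !(addSn, addnS) !qfactS.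
have := qfact_neq0 M; have := qfact_neq0 k; have := qone_neq0 M.
have := qone_neq0 k; rewrite /qone !exprS !exprD => *; field.
by apply/and4P; split.
Qed.

(** Peels superfactorials at successors down to common values of [F], so that [field] can cancel
    them. *)
Ltac qnormS := rewrite !(addSn, addnS) ?(qsuperS, qfactS).

Ltac qnonzero :=
  rewrite -?andbA; repeat (apply/andP; split);
  rewrite ?expf_eq0 ?mulf_neq0 ?qsuper_neq0 ?qfact_neq0 ?qone_neq0 //.

(** MacMahon's box formula for an [l] by [m] by [k] box. *)
Definition rect_form m l k : K :=
  F (l + m + k) * F m * F l * F k / (F (l + m) * F (m + k) * F (l + k)).

Definition rect_det M l k : K :=
  wdet (fun i j => chomz q M (k%:Z - i%:Z + j%:Z)) l 0 0.

Lemma rect_form_neq0 m l k : rect_form m l k != 0.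
Proof. by rewrite /rect_form ?(mulf_neq0, invr_neq0, qsuper_neq0). Qed.

(** The three products differ only by the six [qone] factors of [condensation_identity], here with
    [v = k]. *)
Lemma rect_form_condensation m l k :
  q ^+ k.+1 * (rect_form m l.+2 k.+1 * rect_form m.+2 l k.+1) =
  rect_form m.+1 l.+1 k.+1 ^+ 2
  - rect_form m.+1 l.+1 k.+2 * rect_form m.+1 l.+1 k.
Proof.
apply: (@condensation_identity m l); rewrite /rect_form; qnormS;
  rewrite ?[(m + l)%N]addnC; field; qnonzero.
Qed.

Lemma rect_detE m l k :
  rect_det (l + m) l k = q ^+ (k * 'C(l, 2)) * rect_form m l k.
Proof.
have base0 m' k' : rect_det (0 + m') 0 k' =
    q ^+ (k' * 'C(0, 2)) * rect_form m' 0 k'.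
  rewrite /rect_det /wdet det_mx00 /rect_form /= muln0 expr0 mul1r !add0n.
  rewrite qsuper0; field; qnonzero.
have base1 m' k' : rect_det (1 + m') 1 k' =
    q ^+ (k' * 'C(1, 2)) * rect_form m' 1 k'.
  rewrite /rect_det /wdet det_mx11 mxE muln0 expr0 mul1r.
  rewrite (_ : k'%:Z - _ + _ = Posz k'); last by rewrite /=; lia.
  rewrite -[chomz _ _ _]/(chom q m'.+1 k') chomE /rect_form !add1n addSn.
  rewrite !qsuperS qsuper0 qfact0; field; qnonzero.
(* Condensation ties three consecutive sizes, so two of them are carried through the induction. *)
suff: (forall m k, rect_det (l + m) l k = q ^+ (k * 'C(l, 2)) * rect_form m l k)
   /\ (forall m k, rect_det (l.+1 + m) l.+1 k =
                   q ^+ (k * 'C(l.+1, 2)) * rect_form m l.+1 k) by case.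
elim: l {m k} => [|l [IH0 IH1]]; first by split.
split=> // m [|k].
  (* Condensation at width [k.+1] also involves width [k], so width 0 is treated apart: its matrix
     is unitriangular. *)
  rewrite mul0n expr0 mul1r /rect_form addn0 !addn0 qsuper0.
  rewrite /rect_det /wdet -det_tr det_trig; last first.
    by apply/is_trig_mxP => i j ij; rewrite !mxE chomz_neg //; lia.
  rewrite big1 => [|i _]; first by field; qnonzero.
  rewrite !mxE; set z := (X in chomz _ _ X).
  have -> : z = Posz 0 by rewrite /z; lia.
  by rewrite -[LHS]/(chom _ _ 0) chom0.
have := wdet_condensation
  (fun i j => chomz q (l.+2 + m) (k.+1%:Z - i%:Z + j%:Z)) l 0 0.
rewrite -/(rect_det (l.+2 + m) l.+2 k.+1).
have win x y k' n : k.+1%:Z - x%:Z + y%:Z = k'%:Z ->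
    wdet (fun i j => chomz q (l.+2 + m) (k.+1%:Z - i%:Z + j%:Z)) n x y =
    rect_det (l.+2 + m) n k'.
  by move=> e; apply: wdet_eq => i j _ _; congr chomz; lia.
rewrite !(win 1 1 k.+1) ?(win 0 0 k.+1) ?(win 0 1 k.+2) ?(win 1 0 k)%N;
  try by lia.
have E0 k' : rect_det (l.+2 + m) l k' =
             q ^+ (k' * 'C(l, 2)) * rect_form m.+2 l k'.
  by rewrite -IH0; congr rect_det; lia.
have E1 k' : rect_det (l.+2 + m) l.+1 k' =
             q ^+ (k' * 'C(l.+1, 2)) * rect_form m.+1 l.+1 k'.
  by rewrite -IH1; congr rect_det; lia.
rewrite E0 !E1 => DJ.
apply: (condensation_solve (rect_form_neq0 _ _ _) DJ).
- by rewrite -expr2; apply: rect_form_condensation.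
- by rewrite !(binS, bin1, bin0); lia.
- by lia.
Qed.

(** The array does not depend on [d], which enters only through the size; deleting a last row and
    column therefore just lowers [d]. *)
Definition skew_det M n a b c d : K :=
  wdet (fun i j => chomz q M
      (((if (i < n + a)%N then n + b + c else n + c)%N)%:Z - i%:Z
       - ((if (j < a)%N then c else 0)%N)%:Z + j%:Z)) (n + a + d) 0 0.

(* In [rect_form], [hook_form] and [skew_form] the argument [m] is the number of
   variables minus the number of rows, and the power of [q] is left out. *)
Definition hook_form m n b c d : K :=
  F (n + c + d + m) * F (n + n + b + c + d + m) * F m * F b * F n * F d
    * F (n + c) * F (n + b + d) * F (n + b + c + d)
  / (F (n + d + m) * F (n + c + m) * F (n + b + c + d + m) * F (b + d)
     * F (n + b) * F (n + c + d) * F (n + n + b + c + d)).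

Definition skew_form m n a b c d : K :=
  F (n + a + b + d + m) * F (n + a + c + d + m) * F (n + d + m) * F (n + a + m)
    * F (n + n + a + b + c + d + m) * F m * F b * F c * F n * F a * F d
    * F (n + a + c) * F (n + b + d) * F (n + a + b + c + d)
  / (F (n + a + d + m) ^+ 2 * F (n + b + d + m) * F (n + a + c + m)
     * F (n + a + b + c + d + m) * F (n + m) * F (a + c) * F (b + d)
     * F (n + a + b) * F (n + c + d) * F (n + n + a + b + c + d)).

Lemma hook_form_neq0 m n b c d : hook_form m n b c d != 0.
Proof. by rewrite /hook_form ?(mulf_neq0, invr_neq0, qsuper_neq0). Qed.

Lemma skew_form_neq0 m n a b c d : skew_form m n a b c d != 0.
Proof.
by rewrite /skew_form ?(mulf_neq0, invr_neq0, expf_neq0, qsuper_neq0).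
Qed.

Lemma hook_form_condensation m n b c d :
  q ^+ (n + c).+1 * (hook_form m n.+1 b c d.+1 * hook_form m.+2 n b c.+1 d) =
  hook_form m.+1 n b c.+1 d.+1 * hook_form m.+1 n.+1 b c d
  - hook_form m.+1 n.+1 b c.+1 d * hook_form m.+1 n b c d.+1.
Proof.
(* Here the surviving factors are those with [v = n + c]. *)
apply: (@condensation_identity m (n + b + d)); rewrite /hook_form.
- have -> : (m + (n + c) = n + c + m)%N by lia.
  have -> : (n + b + d + (n + c) = n + n + b + c + d)%N by lia.
  by qnormS; field; qnonzero.
- have -> : (m + (n + b + d) + (n + c) = n + n + b + c + d + m)%N by lia.
  by qnormS; field; qnonzero.
Qed.

Lemma skew_form_condensation m n a b c d :
  q ^+ n.+1 * (skew_form m n.+1 a.+1 b c d.+1 * skew_form m.+2 n.+1 a b c d) =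
  skew_form m.+1 n.+1 a b c d.+1 * skew_form m.+1 n.+1 a.+1 b c d
  - skew_form m.+1 n.+2 a b c d * skew_form m.+1 n a.+1 b c d.+1.
Proof.
(* Here they are those with [v = n]. *)
apply: (@condensation_identity m (n + a + b + c + d).+1); rewrite /skew_form.
- have -> : (m + n = n + m)%N by lia.
  have -> : ((n + a + b + c + d).+1 + n = (n + n + a + b + c + d).+1)%N by lia.
  by qnormS; field; qnonzero.
- have -> : (m + (n + a + b + c + d).+1 + n =
             (n + n + a + b + c + d + m).+1)%N by lia.
  by qnormS; field; qnonzero.
Qed.

Lemma hook_det_rows0 M b c d : skew_det M 0 0 b c d = rect_det M d c.
Proof. by apply: wdet_eq => i j _ _; congr chomz; rewrite /=; lia. Qed.

Lemma hook_det_cols0 M n b c :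
  skew_det M n 0 b c 0 = rect_det M n (n + b + c).
Proof.
rewrite /skew_det !addn0; apply: wdet_eq => i j ir jr.
by congr chomz; rewrite !add0n ir /=; lia.
Qed.

(** Deleting the first row lowers [n], deleting the last lowers [d]; [c] makes up for the change of
    [n] and for the offset of columns against rows. *)
Lemma hook_det_condensation M n b c d :
  skew_det M n.+1 0 b c d.+1 * skew_det M n 0 b c.+1 d =
  skew_det M n 0 b c.+1 d.+1 * skew_det M n.+1 0 b c d
  - skew_det M n.+1 0 b c.+1 d * skew_det M n 0 b c d.+1.
Proof.
rewrite /skew_det !addn0 !(addSn, addnS) /=; set f := (f in wdet f _.+2).
transitivity (wdet f (n + d).+2 0 0 * wdet f (n + d) 1 1).
  congr (_ * _); apply: wdet_eq => i j ir jr; congr chomz.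
  by rewrite !add0n !add1n ltnS; case: ltnP; lia.
rewrite wdet_condensation; congr (_ * _ - _ * _); apply: wdet_eq => i j ir jr;
  by congr chomz; rewrite !(add0n, add1n) ?ltnS; do ?[case: ltnP => ?]; lia.
Qed.

(** Deleting the first row leaves one long row less, deleting the first column one inner part [c]
    less. Their difference [n] thus changes by exactly the amount by which row lengths shift, so [b]
    and [c] stay fixed. *)
Lemma skew_det_condensation M n a b c d :
  skew_det M n.+1 a.+1 b c d.+1 * skew_det M n.+1 a b c d =
  skew_det M n.+1 a b c d.+1 * skew_det M n.+1 a.+1 b c d
  - skew_det M n.+2 a b c d * skew_det M n a.+1 b c d.+1.
Proof.
rewrite /skew_det !(addSn, addnS) /=; set f := (f in wdet f _.+3).
transitivity (wdet f (n + a + d).+3 0 0 * wdet f (n + a + d).+1 1 1).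
  congr (_ * _); apply: wdet_eq => i j ir jr; congr chomz.
  by rewrite !add0n !add1n !ltnS; do ?[case: ltnP => ?]; lia.
rewrite wdet_condensation; congr (_ * _ - _ * _); apply: wdet_eq => i j ir jr;
  by congr chomz; rewrite !(add0n, add1n) ?ltnS; do ?[case: ltnP => ?]; lia.
Qed.

(** For [n = 0] the lower rows end where the upper ones begin: the lower left block has only
    negative degrees. *)
Lemma skew_det_disjoint M a b c d :
  skew_det M 0 a b c d = rect_det M a b * rect_det M d c.
Proof.
rewrite /skew_det !add0n /wdet; set A := (X in \det X).
rewrite -[A]submxK (_ : dlsubmx A = 0); last first.
  apply/matrixP=> i j; rewrite !mxE /= !add0n !ltn_ord.
  rewrite (_ : (a + i < a)%N = false); last by lia.
  by rewrite chomz_neg //; have := ltn_ord j; lia.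
rewrite det_ublock; congr (_ * _); congr (\det _); apply/matrixP=> i j;
  rewrite !mxE /= !add0n; congr chomz.
  by rewrite !ltn_ord; lia.
by do ?[case: ltnP => ?]; lia.
Qed.

(** Reversing rows and columns and transposing preserves the determinant; on the shape it is the
    rotation by 180 degrees. *)
Lemma skew_det_rotate M n a b c : skew_det M n a b c 0 = skew_det M n 0 c b a.
Proof.
rewrite /skew_det !addn0.
pose s : 'S_(n + a) := perm (@rev_ord_inj (n + a)).
rewrite /wdet; set A := (X in \det X = _).
have -> : \det A = \det (row_perm s (col_perm s A))^T.
  rewrite det_tr row_permE col_permE !det_mulmx !det_perm odd_permV mulrCA.
  by rewrite -signr_addb addbb mulr1.
congr (\det _); apply/matrixP=> i j; rewrite !mxE !permE /=.
congr chomz; have := ltn_ord i; have := ltn_ord j => jr ir.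
rewrite !add0n; do ?[case: ltnP => ?]; lia.
Qed.

(** Induction on the number of rows with the number of variables fixed, so that [m] grows as rows
    disappear. *)
Lemma hook_detE m n b c d :
  skew_det (n + d + m) n 0 b c d =
  q ^+ (b * 'C(n, 2) + (n + c) * 'C(n + d, 2)) * hook_form m n b c d.
Proof.
have [r] := ubnP (n + d); elim: r => // r IHr in m n c d *; rewrite ltnS => nd.
case: n nd => [|n] nd.
  rewrite hook_det_rows0 add0n rect_detE muln0 !add0n; congr (_ * _).
  rewrite /rect_form /hook_form !add0n qsuper0 ![(_ + d)%N]addnC !addnA.
  rewrite ![(_ + m)%N]addnC ?addnA; field; qnonzero.
case: d nd => [|d] nd.
  rewrite hook_det_cols0 addn0 rect_detE; congr (q ^+ _ * _).
    by lia.
  rewrite /rect_form /hook_form !addn0 qsuper0.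
  have -> : (n.+1 + m + (n.+1 + b + c) = n.+1 + n.+1 + b + c + m)%N by lia.
  have -> : (m + (n.+1 + b + c) = n.+1 + b + c + m)%N by lia.
  have -> : (n.+1 + (n.+1 + b + c) = n.+1 + n.+1 + b + c)%N by lia.
  field; qnonzero.
set M := (n.+1 + d.+1 + m)%N.
have IH m' n' c' d' : (n' + d' < n.+1 + d.+1)%N -> M = (n' + d' + m')%N ->
    skew_det M n' 0 b c' d' =
    q ^+ (b * 'C(n', 2) + (n' + c') * 'C(n' + d', 2)) * hook_form m' n' b c' d'.
  by move=> h ->; apply: IHr; lia.
have := hook_det_condensation M n b c d.
rewrite (IH m.+2 n c.+1 d) ?(IH m.+1 n c.+1 d.+1) ?(IH m.+1 n.+1 c d)
  ?(IH m.+1 n.+1 c.+1 d) ?(IH m.+1 n c d.+1) /M; try lia.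
move=> DJ; apply: (condensation_solve (hook_form_neq0 _ _ _ _ _) DJ).
- exact: hook_form_condensation.
- by rewrite !(addSn, addnS) !(binS, bin1, bin0); lia.
- by rewrite !(addSn, addnS) !(binS, bin1, bin0); lia.
Qed.

Lemma skew_form_hook m n b c d : skew_form m n 0 b c d = hook_form m n b c d.
Proof.
rewrite /skew_form /hook_form !addn0 !add0n qsuper0; field; qnonzero.
Qed.

Lemma skew_form_rotate m n a b c :
  skew_form m n a b c 0 = hook_form m n c b a.
Proof.
rewrite /skew_form /hook_form !addn0 qsuper0.
have -> : (n + n + c + b + a = n + n + a + b + c)%N by lia.
have -> : (n + b + a = n + a + b)%N by lia.
have -> : (n + c + b + a = n + a + b + c)%N by lia.
have -> : (n + c + a = n + a + c)%N by lia.
have -> : (c + a = a + c)%N by lia.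
field; qnonzero.
Qed.

(** The induction is again on the number of rows: even the condensation term with [n.+2] has one row
    less, as [a] and [d] both drop. *)
Theorem skew_detE m n a b c d :
  skew_det (n + a + d + m) n a b c d =
  q ^+ (b * 'C(n + a, 2) + n * 'C(n + a + d, 2) + c * 'C(n + d, 2))
  * skew_form m n a b c d.
Proof.
have [r] := ubnP (n + a + d).
elim: r => // r IHr in m n a d *; rewrite ltnS => nad.
case: a nad => [|a] nad.
  rewrite !addn0 hook_detE skew_form_hook; congr (q ^+ _ * _); lia.
case: d nad => [|d] nad.
  rewrite skew_det_rotate !addn0 hook_detE skew_form_rotate.
  by congr (q ^+ _ * _); lia.
case: n nad => [|n] nad.
  rewrite skew_det_disjoint !add0n.
  (* The rows of each rectangle count as surplus variables for the other. *)
  rewrite {1}(_ : (a.+1 + d.+1 + m = a.+1 + (d.+1 + m))%N); last by lia.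
  rewrite (_ : (a.+1 + d.+1 + m = d.+1 + (a.+1 + m))%N); last by lia.
  rewrite !rect_detE mulrACA -exprD; congr (q ^+ _ * _); first by lia.
  rewrite /rect_form /skew_form !add0n qsuper0.
  have -> : (a.+1 + (d.+1 + m) + b = a.+1 + b + d.+1 + m)%N by lia.
  have -> : (a.+1 + (d.+1 + m) = a.+1 + d.+1 + m)%N by lia.
  have -> : (d.+1 + m + b = b + d.+1 + m)%N by lia.
  have -> : (d.+1 + (a.+1 + m) + c = a.+1 + c + d.+1 + m)%N by lia.
  have -> : (d.+1 + (a.+1 + m) = a.+1 + d.+1 + m)%N by lia.
  have -> : (a.+1 + m + c = a.+1 + c + m)%N by lia.
  have -> : (d.+1 + c = c + d.+1)%N by lia.
  by field; qnonzero.
set M := (n.+1 + a.+1 + d.+1 + m)%N.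
have IH m' n' a' d' : (n' + a' + d' < n.+1 + a.+1 + d.+1)%N ->
    M = (n' + a' + d' + m')%N ->
    skew_det M n' a' b c d' =
    q ^+ (b * 'C(n' + a', 2) + n' * 'C(n' + a' + d', 2) + c * 'C(n' + d', 2))
    * skew_form m' n' a' b c d'.
  by move=> h ->; apply: IHr; lia.
have := skew_det_condensation M n a b c d.
rewrite (IH m.+2 n.+1 a d) ?(IH m.+1 n.+1 a d.+1) ?(IH m.+1 n.+1 a.+1 d)
  ?(IH m.+1 n.+2 a d) ?(IH m.+1 n a.+1 d.+1) /M; try lia.
move=> DJ; apply: (condensation_solve (skew_form_neq0 _ _ _ _ _ _) DJ).
- exact: skew_form_condensation.
- by rewrite !(addSn, addnS) !(binS, bin1, bin0); lia.
- by rewrite !(addSn, addnS) !(binS, bin1, bin0); lia.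
Qed.

End ClosedForms.

(** * Tableaux on a list of cells *)

Lemma mem_diagram lam (x : cell) :
  (x \in diagram lam) = [&& 0 < x.1, 0 < x.2 & x.2 <= part lam x.1]%N.
Proof.
case: x => i j /=; apply/allpairsPdep/and3P => [[i' [j' []]]|[i0 j0 jl]].
  by rewrite !mem_iota => hi hj [-> ->]; split; lia.
exists i, j; rewrite !mem_iota; split=> //; last by lia.
rewrite i0 /= add1n ltnS -[i]prednK // ltnNge; apply/negP=> h.
by move: jl; rewrite /part nth_default //; lia.
Qed.

Lemma mem_skew lam mu (x : cell) :
  (x \in skew lam mu) =
  [&& 0 < x.1, 0 < x.2 & part mu x.1 < x.2 <= part lam x.1]%N.
Proof. by rewrite mem_filter !mem_diagram; lia. Qed.

Section SchurBox.

Variables (F : fieldType) (q : F) (lam mu : seq nat) (N B : nat).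
Hypothesis lamB : forall i, (nth 0 lam i <= B)%N.

Local Notation pi := (skew lam mu).
Local Notation r := (size lam).
Local Notation box := ('I_r * 'I_B)%type.

Lemma sub_row (y : seq_sub pi) : ((val y).1.-1 < r)%N.
Proof.
have := valP y; rewrite mem_skew => /and4P[y1 y2 _ y3].
rewrite ltnNge; apply/negP=> h; move: y3; rewrite /part nth_default //.
by rewrite leqNgt y2.
Qed.

Lemma sub_col (y : seq_sub pi) : ((val y).2.-1 < B)%N.
Proof.
have := valP y; rewrite mem_skew => /and4P[y1 y2 _ y3].
by apply: leq_trans (lamB (val y).1.-1); rewrite prednK.
Qed.

Definition box_of (y : seq_sub pi) : box :=
  (Ordinal (sub_row y), Ordinal (sub_col y)).

Definition cell_of (x : box) : cell := (x.1.+1, x.2.+1).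

Lemma box_ofK y : cell_of (box_of y) = val y.
Proof.
have := valP y; rewrite mem_skew => /and4P[y1 y2 _ _].
by rewrite [RHS]surjective_pairing /cell_of /= !prednK.
Qed.

Lemma cell_of_inj : injective cell_of.
Proof. by move=> [i j] [i' j'] [/val_inj-> /val_inj->]. Qed.

Lemma mem_cell_of x :
  (cell_of x \in pi) = in_shape (nth 0%N lam) (nth 0%N mu) x.
Proof. by rewrite mem_skew /part /in_shape /= ltnS. Qed.

(** The default 0 is the value that [box_tableau] imposes off the shape, and it adds nothing to the
    weight. *)
Definition to_box (T : {ffun seq_sub pi -> 'I_N.+1}) : {ffun box -> 'I_N.+1} :=
  [ffun x => oapp T ord0 (insub (cell_of x))].

Definition of_box (T : {ffun box -> 'I_N.+1}) : {ffun seq_sub pi -> 'I_N.+1} :=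
  [ffun y => T (box_of y)].

Lemma to_box_of T y : to_box T (box_of y) = T y.
Proof. by rewrite ffunE box_ofK valK. Qed.

Lemma box_of_surj x : in_shape (nth 0%N lam) (nth 0%N mu) x ->
  exists y, x = box_of y.
Proof.
rewrite -mem_cell_of => xs; exists (Sub (cell_of x) xs).
by apply: cell_of_inj; rewrite box_ofK SubK.
Qed.

Lemma to_box_out T x : ~~ in_shape (nth 0%N lam) (nth 0%N mu) x ->
  to_box T x = ord0.
Proof. by rewrite -mem_cell_of => xs; rewrite ffunE insubN. Qed.

Lemma to_boxK : cancel to_box of_box.
Proof. by move=> T; apply/ffunP=> y; rewrite ffunE to_box_of. Qed.

Lemma in_shape_box_of y : in_shape (nth 0%N lam) (nth 0%N mu) (box_of y).
Proof. by rewrite -mem_cell_of box_ofK; apply: valP. Qed.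

Lemma of_boxK T : box_tableau N.+1 (nth 0%N lam) (nth 0%N mu) T ->
  to_box (of_box T) = T.
Proof.
move=> /box_tableauP[_ T0 _ _]; apply/ffunP=> x.
have [xs|xs] := boolP (in_shape (nth 0%N lam) (nth 0%N mu) x).
  by have [y ->] := box_of_surj xs; rewrite to_box_of ffunE.
by rewrite to_box_out //; apply: val_inj; rewrite /= T0.
Qed.

Lemma semistandard_to_box T :
  box_tableau N.+1 (nth 0%N lam) (nth 0%N mu) (to_box T) = semistandard T.
Proof.
apply/box_tableauP/forallP => [[_ _ H3 H4] y|H].
  apply/forallP=> z; rewrite -!to_box_of -!box_ofK.
  have := in_shape_box_of y; have := in_shape_box_of z.
  case: (box_of y) (box_of z) => i j [i' j'] sz sy /=.
  rewrite !eqSS !ltnS.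
  apply/andP; split; apply/implyP=> /andP[/eqP/ord_inj e h].
    by move: sz; rewrite -e => sz; apply: H3.
  by move: sz; rewrite -e => sz; apply: H4.
split.
- by move=> x _; apply: ltn_ord.
- by move=> x xs; rewrite to_box_out.
- move=> i j j' s s' jj; have [y ey] := box_of_surj s.
  have [z ez] := box_of_surj s'; have /forallP/(_ z)/andP[/implyP] := H y.
  by rewrite -!to_box_of -!box_ofK -ey -ez /= eqxx ltnS => h _; apply: h.
- move=> j i i' s s' jj; have [y ey] := box_of_surj s.
  have [z ez] := box_of_surj s'; have /forallP/(_ z)/andP[_ /implyP] := H y.
  by rewrite -!to_box_of -!box_ofK -ey -ez /= eqxx ltnS => h; apply: h.
Qed.

Lemma to_box_weight T : (\sum_x to_box T x = \sum_y T y)%N.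
Proof.
rewrite [RHS](partition_big box_of xpredT) //=; apply: eq_bigr => x _.
have [xs|xs] := boolP (in_shape (nth 0%N lam) (nth 0%N mu) x).
  have [y ->] := box_of_surj xs; rewrite to_box_of (big_pred1 y) // => z.
  apply/eqP/eqP => [e|-> //]; apply: val_inj.
  by rewrite -!box_ofK e.
rewrite to_box_out // big_pred0 // => y; apply/negbTE.
by apply: contra xs => /eqP <-; apply: in_shape_box_of.
Qed.

Lemma schur_box_sum :
  schur_principal pi N q = box_sum q r B N N.+1 (nth 0%N lam) (nth 0%N mu).
Proof.
rewrite /box_sum (reindex_onto to_box of_box) /=; last exact: of_boxK.
apply: eq_big => T; first by rewrite to_boxK eqxx andbT semistandard_to_box.
by rewrite to_box_weight.
Qed.

End SchurBox.

(** * The partition of the theorem *)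

Section FatHook.

Variables n a b c d : nat.

Definition fat_hook : seq nat :=
  nseq (n + a) (n + b + c)%N ++ nseq d (n + c)%N.

Lemma size_fat_hook : size fat_hook = (n + a + d)%N.
Proof. by rewrite size_cat !size_nseq. Qed.

Lemma nth_fat_hook i : nth 0%N fat_hook i =
  (if i < n + a then n + b + c else if i < n + a + d then n + c else 0)%N.
Proof.
rewrite nth_cat size_nseq !nth_nseq; case: ltnP => // h.
by do ?[case: ltnP => ?]; lia.
Qed.

Lemma conj_fat_hook j : conj_part fat_hook j.+1 =
  ((if j < n + b + c then n + a else 0) + (if j < n + c then d else 0))%N.
Proof.
rewrite /conj_part count_cat !count_nseq.
by do 2!case: ltnP => ?; rewrite ?mul1n ?mul0n.
Qed.

End FatHook.

Lemma schur_skew_det (F : fieldType) (q : F) n a b c d N :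
  schur_principal (skew (fat_hook n a b c d) (nseq a c)) N q =
  skew_det q N.+1 n a b c d.
Proof.
rewrite (@schur_box_sum _ _ _ _ _ (n + b + c)); last first.
  by move=> i; rewrite nth_fat_hook; do ?[case: ltnP => ?]; lia.
rewrite jacobi_trudi //; last 5 first.
- by move=> i; rewrite !nth_fat_hook; do ?[case: ltnP => ?]; lia.
- by rewrite nth_fat_hook size_fat_hook; do ?[case: ltnP => ?]; lia.
- by move=> i; rewrite !nth_nseq; do ?[case: ltnP => ?]; lia.
- move=> i; rewrite size_fat_hook nth_fat_hook nth_nseq.
  by do ?[case: ltnP => ?]; lia.
- by move=> i; rewrite nth_fat_hook; do ?[case: ltnP => ?]; lia.
rewrite size_fat_hook; congr (\det _); apply/matrixP=> i j.
by rewrite !mxE nth_fat_hook nth_nseq !add0n (ltn_ord i).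
Qed.

(** * Polynomials in [q^N] *)

Section PolynomialInPower.

Variables (K : fieldType) (q : K).
Hypothesis q0 : q != 0.
Hypothesis qX1 : forall k, q ^+ k.+1 != 1.

Definition qpoly (f : nat -> K) : Prop :=
  exists p : {poly K}, forall N, f N = p.[q ^+ N].

Lemma qpoly_ext f g : f =1 g -> qpoly f -> qpoly g.
Proof. by move=> e [p fp]; exists p => N; rewrite -e. Qed.

Lemma qpoly_const x : qpoly (fun=> x).
Proof. by exists x%:P => N; rewrite hornerC. Qed.

Lemma qpolyD f g : qpoly f -> qpoly g -> qpoly (fun N => f N + g N).
Proof.
by move=> [p fp] [p' gp]; exists (p + p') => N; rewrite hornerD fp gp.
Qed.

Lemma qpolyM f g : qpoly f -> qpoly g -> qpoly (fun N => f N * g N).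
Proof.
by move=> [p fp] [p' gp]; exists (p * p') => N; rewrite hornerM fp gp.
Qed.

Lemma qpoly_sum I (s : seq I) (f : I -> nat -> K) :
  (forall i, qpoly (f i)) -> qpoly (fun N => \sum_(i <- s) f i N).
Proof.
move=> fp; elim: s => [|i s IH].
  by apply: qpoly_ext (qpoly_const 0) => N; rewrite big_nil.
by apply: qpoly_ext (qpolyD (fp i) IH) => N; rewrite big_cons.
Qed.

Lemma qpoly_prod I (s : seq I) (f : I -> nat -> K) :
  (forall i, qpoly (f i)) -> qpoly (fun N => \prod_(i <- s) f i N).
Proof.
move=> fp; elim: s => [|i s IH].
  by apply: qpoly_ext (qpoly_const 1) => N; rewrite big_nil.
by apply: qpoly_ext (qpolyM (fp i) IH) => N; rewrite big_cons.
Qed.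

Lemma qpoly_det n (A : nat -> 'M[K]_n) :
  (forall i j, qpoly (fun N => A N i j)) -> qpoly (fun N => \det (A N)).
Proof.
move=> Ap; apply: qpoly_sum => s; apply: qpolyM (qpoly_const _) _.
by apply: qpoly_prod => i; apply: Ap.
Qed.

Lemma qpoly_1sub x : qpoly (fun N => 1 - q ^+ N * x).
Proof.
exists (1 - x *: 'X) => N.
by rewrite hornerD hornerN hornerZ hornerX hornerC mulrC.
Qed.

Lemma expr_inj : injective (fun N => q ^+ N).
Proof.
move=> i j; wlog ij : i j / (i <= j)%N.
  by move=> W; case: (leqP i j) => [|/ltnW] h e; [|symmetry]; apply: W.
move=> /= e; apply/eqP; rewrite eqn_leq ij -subn_eq0 /=.
case ek : (j - i)%N => [//|k]; have := qX1 k; rewrite -ek => /eqP[].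
by apply: (mulfI (expf_neq0 i q0)); rewrite mulr1 -exprD subnKC.
Qed.

(** The powers of [q] are distinct, so the difference of the two polynomials would have as many
    roots as its size. *)
Lemma qpoly_eventually_eq f g N0 : qpoly f -> qpoly g ->
  (forall N, (N0 <= N)%N -> f N = g N) -> f =1 g.
Proof.
move=> [p fp] [p' gp] fg N; rewrite fp gp; congr _.[_].
apply/eqP; rewrite -subr_eq0; apply: contraT => nz.
have := @max_poly_roots _ _
  [seq q ^+ (N0 + i)%N | i <- iota 0 (size (p - p'))] nz.
rewrite size_map size_iota ltnn; apply.
  apply/allP=> _ /mapP[i _ ->].
  by rewrite rootE hornerD hornerN -fp -gp fg ?leq_addr // subrr.
by rewrite map_inj_uniq ?iota_uniq // => i j /expr_inj/addnI.
Qed.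

(** Cancelling [qfact q N] in [chomE] leaves [k] factors, a number independent of [N]. *)
Lemma qpoly_chomz z : qpoly (fun N => chomz q N.+1 z).
Proof.
case: z => k; last exact: qpoly_const.
pose f N := (qfact q k)^-1 * \prod_(i <- iota 0 k) (1 - q ^+ N * q ^+ i.+1).
have fp : qpoly f.
  apply: qpolyM (qpoly_const _) _; apply: qpoly_prod => i; exact: qpoly_1sub.
apply: qpoly_ext fp => N; rewrite /f /= -[RHS]/(chom q N.+1 k) chomE //.
have -> : qfact q (N + k) =
    qfact q N * \prod_(i <- iota 0 k) (1 - q ^+ N * q ^+ i.+1).
  rewrite /qfact -!(big_mkord xpredT (qone q)).
  rewrite (big_cat_nat _ (leq_addr k N)) //=.
  congr (_ * _); rewrite -{1}[N]add0n big_addn addKn /index_iota subn0.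
  by apply: eq_bigr => i _; rewrite /qone -exprD addnC addnS.
by field; rewrite !qfact_neq0.
Qed.

Lemma qpoly_skew_det n a b c d : qpoly (fun N => skew_det q N.+1 n a b c d).
Proof.
apply: qpoly_det => i j; refine (qpoly_ext _ (qpoly_chomz _)).
by move=> N; rewrite mxE; reflexivity.
Qed.

(** A negative [z] is harmless, since [q ^ z] goes into the coefficients. *)
Lemma qpoly_qpoch (z : int) k : qpoly (fun N => qpoch (q ^ (N%:Z + z)) q k).
Proof.
apply: qpoly_prod => i; apply: qpoly_ext (qpoly_1sub (q ^ z * q ^+ i)) => N.
by rewrite expfzDr // mulrA.
Qed.

End PolynomialInPower.

(** * The product formula *)

Lemma big_diagram (R : Type) (idx : R) (op : Monoid.com_law idx) (lam : seq nat)
    (Pr : pred cell) (G : cell -> R) :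
  \big[op/idx]_(x <- diagram lam | Pr x) G x =
  \big[op/idx]_(0 <= i < size lam)
    \big[op/idx]_(0 <= j < nth 0%N lam i | Pr (i.+1, j.+1)) G (i.+1, j.+1).
Proof.
rewrite /diagram big_mkcond big_allpairs_dep /= /index_iota subn0.
rewrite (iotaDl 1 0) big_map; apply: eq_bigr => i _.
rewrite (iotaDl 1 0) big_map /part /= subn0 [RHS]big_mkcond.
by apply: eq_bigr.
Qed.

(** * The exponent of [q] *)

Section FatHookWeight.

Variables n a b c d : nat.

Local Notation fat_hook := (fat_hook n a b c d).

(** The first [n + c] columns reach the last row, and [c] of them are missing when [i < a]; the
    further [b] columns end at row [n + a]. *)
Lemma fat_hook_row_weight i : (i < n + a + d)%N ->
  \sum_(0 <= j < nth 0%N fat_hook i | (i.+1, j.+1) \notin diagram (nseq a c))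
     ((conj_part fat_hook j.+1)%:Z - i.+1%:Z) =
  ((n + c * (a <= i)) * (n + a + d - i.+1)
   + (i < n + a) * (b * (n + a - i.+1)))%N%:Z.
Proof.
move=> ir; pose w := (n + a + d - i.+1)%N.
have Pr j : ((i.+1, j.+1) \notin diagram (nseq a c)) = ((i < a) ==> (c <= j))%N.
  by rewrite mem_diagram /part /= nth_nseq; case: (ltnP i a) => ?; lia.
have W : \sum_(0 <= j < n + c | (i.+1, j.+1) \notin diagram (nseq a c))
     ((conj_part fat_hook j.+1)%:Z - i.+1%:Z) = ((n + c * (a <= i)) * w)%N%:Z.
  transitivity (\sum_(0 <= j < n + c | ((i < a) ==> (c <= j))%N) w%:Z).
    rewrite big_nat_cond [RHS]big_nat_cond; apply: eq_big => [j|j /andP[jc _]].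
      by rewrite Pr.
    by rewrite conj_fat_hook /w; do ?[case: ltnP => ?]; lia.
  case: (ltnP i a) => h.
    have -> : \sum_(0 <= j < n + c | (true ==> (c <= j))%N) w%:Z =
              \sum_(c <= j < n + c) w%:Z by rewrite [RHS](big_nat_widenl _ 0).
    by rewrite sumr_const_nat -mulr_natr natz; lia.
  by rewrite sumr_const_nat -mulr_natr natz subn0 muln1 PoszM mulrC.
rewrite nth_fat_hook; case: ltnP => h; last first.
  by rewrite ir W mul0n addn0.
rewrite (@big_cat_nat _ _ _ (n + c)) //=; last by lia.
rewrite W PoszD; congr (_ + _).
transitivity (\sum_(n + c <= j < n + b + c) (n + a - i.+1)%N%:Z).
  rewrite big_nat_cond [RHS]big_nat_cond; apply: eq_big => [j|j /andP[jc _]].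
    by rewrite Pr; lia.
  by rewrite conj_fat_hook; do ?[case: ltnP => ?]; lia.
by rewrite sumr_const_nat -mulr_natr natz; lia.
Qed.

(** Three triangular sums: [b] columns over the first [n + a] rows, [n] over all rows, [c] over the
    last [n + d] rows. *)
Lemma fat_hook_weight :
  \sum_(x <- skew fat_hook (nseq a c))
     ((conj_part fat_hook x.2)%:Z - x.1%:Z) =
  (b * 'C(n + a, 2) + n * 'C(n + a + d, 2) + c * 'C(n + d, 2))%N%:Z.
Proof.
rewrite big_filter big_diagram size_fat_hook.
under eq_big_nat => i /andP[_ ir] do rewrite fat_hook_row_weight //.
rewrite -(big_morph Posz PoszD (erefl _)); congr Posz.
under eq_bigr => i _ do rewrite mulnDl.
rewrite !big_split /= -big_distrr /=.
have rev k : (\sum_(0 <= i < k) (k - i.+1) = 'C(k, 2))%N.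
  by rewrite -bin2_sum [RHS]big_nat_rev.
rewrite rev addnC addnA; congr (_ + _ + _)%N.
  rewrite -rev big_distrr /= [RHS](big_nat_widen _ _ (n + a + d)) ?leq_addr //.
  by rewrite [RHS]big_mkcond; apply: eq_bigr => i _; case: ltnP; rewrite ?mul1n.
under eq_bigr => i _ do rewrite -mulnA.
rewrite -big_distrr /=; congr (_ * _)%N.
rewrite -bin2_sum big_nat_rev /= [RHS](big_nat_widen _ _ (n + a + d));
  last by lia.
rewrite [RHS]big_mkcond; apply: eq_big_nat => i ir.
rewrite add0n (_ : (a <= _)%N = (i < n + d)%N); last by lia.
by case: ltnP => h /=; rewrite ?mul1n; lia.
Qed.

End FatHookWeight.

(** * Products over rectangles of cells *)

Section ProductFormula.

Variables (K : fieldType) (q : K).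
Hypothesis q0 : q != 0.
Hypothesis qX1 : forall k, q ^+ k.+1 != 1.

Local Notation F := (qsuper q).

Definition qrect x p s : K :=
  \prod_(0 <= i < p) \prod_(0 <= j < s) qone q (x + i + j).

Lemma qfactD x s :
  qfact q (x + s) = qfact q x * \prod_(0 <= j < s) qone q (x + j).
Proof.
elim: s => [|s IH]; first by rewrite big_nil addn0 mulr1.
by rewrite addnS qfactS IH big_nat_recr //= mulrA.
Qed.

(** The product telescopes to superfactorials at the four corners. Naming the sums lets each use
    prescribe the form they take in [skew_form]. *)
Lemma qrectE x p s y y1 y2 :
    (x + p + s = y)%N -> (x + p = y1)%N -> (x + s = y2)%N ->
  qrect x p s = F y * F x / (F y1 * F y2).
Proof.
move=> <- <- <-; elim: p => [|p IH].
  rewrite /qrect big_nil addn0; field; rewrite !qsuper_neq0 //.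
rewrite /qrect big_nat_recr //= -/(qrect x p s) IH addnS addSn !qsuperS.
have -> : \prod_(0 <= j < s) qone q (x + p + j) =
          qfact q (x + p + s) / qfact q (x + p).
  by rewrite qfactD mulrC mulKf ?qfact_neq0.
by field; rewrite !(qsuper_neq0, qfact_neq0).
Qed.

Lemma qpochE (z : int) e k : z = e.+1%:Z ->
  qpoch (q ^ z) q k = \prod_(0 <= j < k) qone q (e + j).
Proof.
by move=> ->; apply: eq_bigr => j _; rewrite /qone -exprnP -exprD addSn.
Qed.

Lemma prod_qpoch1 n a b d m N : (N.+1 = n + a + d + m)%N ->
  \prod_(1 <= i < b.+1) qpoch (q ^ (N%:Z - a%:Z + 1 + i%:Z)) q a =
  qrect (n + d + m) b a.
Proof.
move=> hN; rewrite big_add1; apply: eq_big_nat => i _; apply: qpochE.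
by lia.
Qed.

Lemma prod_qpoch2 n a c d m N : (N.+1 = n + a + d + m)%N ->
  \prod_(1 <= i < d.+1) qpoch (q ^ (N%:Z + 2 - i%:Z)) q c =
  qrect (n + a + m) d c.
Proof.
(* The exponents decrease with [i], hence the reversal. *)
move=> hN; rewrite big_add1 big_nat_rev; apply: eq_big_nat => i id.
by apply: qpochE; lia.
Qed.

Lemma prod_qpoch3 n a d m k N : (N.+1 = n + a + d + m)%N ->
  \prod_(1 <= i < n.+1)
     qpoch (q ^ (N%:Z - n%:Z - a%:Z - d%:Z + 1 + i%:Z)) q k = qrect m n k.
Proof.
move=> hN; rewrite big_add1; apply: eq_big_nat => i _; apply: qpochE.
by lia.
Qed.

(** The product over [k] telescopes to its two ends. *)
Lemma prod_box n a c :
  \prod_(1 <= i < n.+1) \prod_(1 <= j < a.+1) \prod_(1 <= k < c.+1)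
    ((1 - q ^ (i%:Z + j%:Z + k%:Z - 1)) / (1 - q ^ (i%:Z + j%:Z + k%:Z - 2))) =
  qrect c n a / qrect 0 n a.
Proof.
rewrite big_add1 -prodf_div; apply: eq_bigr => i _.
rewrite big_add1 -prodf_div; apply: eq_bigr => j _.
rewrite big_add1 /=; transitivity
  (\prod_(0 <= k < c) (qone q (k.+1 + i + j) / qone q (k + i + j))).
  apply: eq_bigr => k _.
  have -> : i.+1%:Z + j.+1%:Z + k.+1%:Z - 1 = (k.+1 + i + j).+1%:Z by lia.
  have -> // : i.+1%:Z + j.+1%:Z + k.+1%:Z - 2 = (k + i + j).+1%:Z by lia.
elim: c => [|c IH]; first by rewrite big_nil divff ?qone_neq0.
rewrite big_nat_recr //= IH; field; by rewrite !qone_neq0.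
Qed.

(** Hook lengths fall by one with each step right or down inside a rectangle, so they form a [qrect]
    when read from its lower right corner. *)
Lemma prod_rect_rev x0 y0 x p s (G : nat -> nat -> K) :
    (forall i j, (i < p)%N -> (j < s)%N ->
       G (x0 + i)%N (y0 + j)%N = (qone q (x + (p - i.+1) + (s - j.+1)))^-1) ->
  \prod_(x0 <= i < x0 + p) \prod_(y0 <= j < y0 + s) G i j = (qrect x p s)^-1.
Proof.
move=> EG; rewrite -{1}[x0]add0n big_addn addKn -prodfV [RHS]big_nat_rev /=.
apply: eq_big_nat => i ip; rewrite -{1}[y0]add0n big_addn addKn -prodfV.
rewrite [RHS]big_nat_rev /=; apply: eq_big_nat => j js.
by rewrite [(i + x0)%N]addnC [(j + y0)%N]addnC EG ?add0n //; lia.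
Qed.

(** The remaining cells form four rectangles: the last [b] columns, the rest of the first [n] rows,
    the [n] columns right of the removed block, and the last [d] rows. Each offset is the corner
    hook length minus one. *)
Lemma prod_hooks n a b c d :
  \prod_(x <- cells_diff (diagram (fat_hook n a b c d))
                         (skew (nseq (n + a) c) (nseq n c)))
     (1 - q ^ hook (fat_hook n a b c d) x)^-1 =
  (qrect 0 (n + a) b * qrect (a + b + d) n (n + c) * qrect (b + d) a n
   * qrect 0 d (n + c))^-1.
Proof.
set lam := fat_hook n a b c d.
(* The value 1 on removed cells turns the filtered product into one over full intervals, which can
   be split. *)
pose H i j := if (i.+1, j.+1) \notin skew (nseq (n + a) c) (nseq n c)
              then (1 - q ^ hook lam (i.+1, j.+1))^-1 else 1.
have Bn i j : ((i.+1, j.+1) \notin skew (nseq (n + a) c) (nseq n c)) =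
              ~~ ((n <= i < n + a) && (j < c))%N.
  rewrite mem_skew /part /= !nth_nseq.
  by case: (ltnP i n); case: (ltnP i (n + a)); lia.
have HE i j e : (i.+1, j.+1) \notin skew (nseq (n + a) c) (nseq n c) ->
    hook lam (i.+1, j.+1) = e.+1%:Z -> H i j = (qone q e)^-1.
  by move=> nB hh; rewrite /H nB hh.
rewrite big_filter big_diagram size_fat_hook.
under eq_bigr => i _ do rewrite big_mkcond -/(H i _).
rewrite (@big_cat_nat _ _ _ (n + a)) ?leq_addr //= [RHS]invfM; congr (_ * _).
  transitivity (\prod_(0 <= i < n + a) (\prod_(0 <= j < n + c) H i j *
       \prod_(n + c <= j < n + c + b) H i j)).
    apply: eq_big_nat => i /andP[_ ir]; rewrite nth_fat_hook ir.
    rewrite -(@big_cat_nat _ _ _ (n + c)) ?leq_addr //=.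
    by congr (\prod_(0 <= _ < _) _); lia.
  rewrite big_split /= mulrC -[in RHS]mulrA [RHS]invfM; congr (_ * _).
    apply: (@prod_rect_rev 0 (n + c)) => i j ip js; rewrite add0n; apply: HE.
      by rewrite Bn; lia.
    rewrite /hook /part /= nth_fat_hook conj_fat_hook.
    by do ?[case: ltnP => ?]; lia.
  rewrite (@big_cat_nat _ _ _ n) ?leq_addr //= [RHS]invfM; congr (_ * _).
    apply: (@prod_rect_rev 0 0) => i j ip js; rewrite !add0n; apply: HE.
      by rewrite Bn; lia.
    rewrite /hook /part /= nth_fat_hook conj_fat_hook.
    by do ?[case: ltnP => ?]; lia.
  transitivity (\prod_(n <= i < n + a) \prod_(c <= j < c + n) H i j).
    apply: eq_big_nat => i ir; rewrite (@big_cat_nat _ _ _ c) ?leq_addl //=.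
    (* In these rows the first [c] columns are the removed block. *)
    rewrite [X in X * _]big_nat_cond [X in X * _]big1 ?mul1r; last first.
      by move=> j jc; rewrite /H Bn ifF //; lia.
    by rewrite addnC.
  apply: prod_rect_rev => i j ip js; apply: HE.
    by rewrite Bn; lia.
  rewrite /hook /part /= nth_fat_hook conj_fat_hook.
  by do ?[case: ltnP => ?]; lia.
transitivity
  (\prod_(n + a <= i < n + a + d) \prod_(0 <= j < 0 + (n + c)) H i j).
  apply: eq_big_nat => i /andP[h ir]; rewrite nth_fat_hook ltnNge h /= ir.
  by [].
apply: prod_rect_rev => i j ip js; rewrite !add0n; apply: HE.
  by rewrite Bn; lia.
rewrite /hook /part /= nth_fat_hook conj_fat_hook.
by do ?[case: ltnP => ?]; lia.
Qed.

(** Every factor is a product or quotient of [qrect]s; expanded at their corners, the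
    superfactorials cancel down to [skew_form]. *)
Lemma skew_product_formula n a b c d m N : (N.+1 = n + a + d + m)%N ->
  skew_form q m n a b c d =
  \prod_(1 <= i < b.+1) qpoch (q ^ (N%:Z - a%:Z + 1 + i%:Z)) q a
    * \prod_(1 <= i < d.+1) qpoch (q ^ (N%:Z + 2 - i%:Z)) q c
    * \prod_(1 <= i < n.+1)
        qpoch (q ^ (N%:Z - n%:Z - a%:Z - d%:Z + 1 + i%:Z)) q
              (n + a + b + c + d)%N
    * \prod_(1 <= i < n.+1) \prod_(1 <= j < a.+1) \prod_(1 <= k < c.+1)
        ((1 - q ^ (i%:Z + j%:Z + k%:Z - 1))
         / (1 - q ^ (i%:Z + j%:Z + k%:Z - 2)))
    * \prod_(x <- cells_diff (diagram (fat_hook n a b c d))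
                             (skew (nseq (n + a) c) (nseq n c)))
        (1 - q ^ hook (fat_hook n a b c d) x)^-1.
Proof.
move=> hN; rewrite (prod_qpoch1 _ hN) (prod_qpoch2 _ hN) (prod_qpoch3 _ hN).
rewrite prod_box prod_hooks.
rewrite (@qrectE (n + d + m) b a (n + a + b + d + m) (n + b + d + m)
                 (n + a + d + m)); try lia.
rewrite (@qrectE (n + a + m) d c (n + a + c + d + m) (n + a + d + m)
                 (n + a + c + m)); try lia.
rewrite (@qrectE m n (n + a + b + c + d) (n + n + a + b + c + d + m) (n + m)
                 (n + a + b + c + d + m)); try lia.
rewrite (@qrectE c n a (n + a + c) (n + c) (a + c)); try lia.
rewrite (@qrectE 0 n a (n + a) n a); try lia.
rewrite (@qrectE 0 (n + a) b (n + a + b) (n + a) b); try lia.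
rewrite (@qrectE (a + b + d) n (n + c) (n + n + a + b + c + d) (n + a + b + d)
                 (n + a + b + c + d)); try lia.
rewrite (@qrectE (b + d) a n (n + a + b + d) (a + b + d) (n + b + d)); try lia.
rewrite (@qrectE 0 d (n + c) (n + c + d) d (n + c)); try lia.
rewrite /skew_form qsuper0; field.
by rewrite !qsuper_neq0.
Qed.

End ProductFormula.

(** * The theorem over the field of rational functions *)

Lemma ratq_neq0 : ratq != 0.
Proof. by rewrite tofrac_eq0 polyX_eq0. Qed.

Lemma ratq_expS_neq1 k : ratq ^+ k.+1 != 1.
Proof.
rewrite -rmorphXn -tofrac1 -subr_eq0 -rmorphB tofrac_eq0.
by rewrite -size_poly_eq0 size_XnsubC.
Qed.

Theorem theorem5p1 (n a b c d N : nat) :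
  let q := ratq in
  let lam := nseq (n + a) (n + b + c)%N ++ nseq d (n + c)%N in
  let pi := skew lam (nseq a c) in
  schur_principal pi N q =
    q ^ (\sum_(x <- pi) ((conj_part lam x.2)%:Z - x.1%:Z))
    * \prod_(1 <= i < b.+1) qpoch (q ^ (N%:Z - a%:Z + 1 + i%:Z)) q a
    * \prod_(1 <= i < d.+1) qpoch (q ^ (N%:Z + 2 - i%:Z)) q c
    * \prod_(1 <= i < n.+1)
        qpoch (q ^ (N%:Z - n%:Z - a%:Z - d%:Z + 1 + i%:Z)) q
              (n + a + b + c + d)%N
    * \prod_(1 <= i < n.+1) \prod_(1 <= j < a.+1) \prod_(1 <= k < c.+1)
        ((1 - q ^ (i%:Z + j%:Z + k%:Z - 1))
         / (1 - q ^ (i%:Z + j%:Z + k%:Z - 2)))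
    * \prod_(x <- cells_diff (diagram lam)
                             (skew (nseq (n + a) c) (nseq n c)))
        (1 - q ^ hook lam x)^-1.
Proof.
move=> q lam pi.
have q0 : q != 0 := ratq_neq0.
have qX1 : forall k, q ^+ k.+1 != 1 := ratq_expS_neq1.
(* From [N = n + a + d] on there are at least as many variables as rows, as [skew_detE] requires. *)
move: N; apply: (@qpoly_eventually_eq _ q q0 qX1 _ _ (n + a + d)).
- apply: (@qpoly_ext _ q (fun N => skew_det q N.+1 n a b c d)).
    by move=> N; rewrite -schur_skew_det.
  exact: qpoly_skew_det.
(* Each exponent is [N] plus an integer independent of [N]. *)
- have poch (z : nat -> int) (k : nat) (e : nat -> nat -> int) s :
      (forall N i, e N i = N%:Z + z i) ->
    qpoly q (fun N => \prod_(i <- s) qpoch (q ^ e N i) q k).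
    move=> ez; apply: qpoly_prod => i.
    by apply: qpoly_ext (qpoly_qpoch q0 (z i) k) => N; rewrite ez.
  apply: qpolyM (qpoly_const q _); apply: qpolyM (qpoly_const q _).
  apply: qpolyM.
    apply: qpolyM.
      apply: qpolyM (qpoly_const q _) _.
      by apply: (poch (fun i => - a%:Z + 1 + i%:Z)) => N i; lia.
    by apply: (poch (fun i => 2 - i%:Z)) => N i; lia.
  apply: (poch (fun i => - n%:Z - a%:Z - d%:Z + 1 + i%:Z)) => N i; lia.
move=> N hN; pose m := (N.+1 - (n + a + d))%N.
have eN : (N.+1 = n + a + d + m)%N by rewrite /m; lia.
rewrite schur_skew_det {1}eN skew_detE // (skew_product_formula q0 qX1 b c eN).
rewrite fat_hook_weight -exprnP.
by rewrite !mulrA.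
Qed.
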